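(* Unless the Exponential Time Hypothesis fails, Offensive Alliance does not admit a $2^{o(n)}$-time algorithm, where $n$ is the number of vertices of the input graph, even when restricted to bipartite graphs.
   Context: All graphs are finite, simple and undirected. For $S\subseteq V(G)$, $N(S)$ is the open neighbourhood of $S$, $S^c=V(G)\setminus S$, and $d_S(v)$ is the number of neighbours of $v$ in $S$. A non-empty set $S\subseteq V(G)$ is an offensive alliance if $d_S(v)\ge d_{S^c}(v)+1$ for every $v\in N(S)$. Offensive Alliance: given a graph $G$ and integer $r\ge 1$, is there an offensive alliance $S$ with $1\le |S|\le r$? *)

(* Defs.v *)
From HB Require Import structures.
From mathcomp Require Import all_boot all_order all_algebra.
From mathcomp Require Import all_classical all_reals all_analysis.
Import Order.TTheory GRing.Theory Num.Theory.
Import numFieldNormedType.Exports.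

Set Implicit Arguments.
Unset Strict Implicit.
Unset Printing Implicit Defensive.

(** Algorithms are programs of the WHILE language of N. D. Jones
    ("Computability and Complexity: From a Programming Perspective", 1997),
    with his cost measure: one unit for each operator evaluated and each
    command or test performed. The data are binary trees; the only test is
    "is this tree a leaf", so values can be implemented as pointers into a
    shared heap, each unit of cost being one elementary step. WHILE programs
    and multitape Turing machines simulate each other with polynomial overhead;
    replacing a time T by T^O(1) affects neither [ETH] nor the class of 2^o(n)
    time bounds. *)

Inductive tree : Type := Leaf | Node (l r : tree).

Fixpoint tree_size (d : tree) : nat :=
  if d is Node l r then (tree_size l + tree_size r).+1 else 1.

Definition tree_hd (d : tree) : tree := if d is Node l _ then l else Leaf.
Definition tree_tl (d : tree) : tree := if d is Node _ r then r else Leaf.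

Inductive expr : Type :=
  | Var (x : nat)
  | Nil
  | Cons (e1 e2 : expr)
  | Hd (e : expr)
  | Tl (e : expr).

Inductive com : Type :=
  | Assign (x : nat) (e : expr)
  | Seq (c1 c2 : com)
  | If (e : expr) (c1 c2 : com)
  | While (e : expr) (c : com).

Definition store := nat -> tree.

Definition upd (s : store) (x : nat) (d : tree) : store :=
  fun y => if y == x then d else s y.

Fixpoint eval (s : store) (e : expr) : tree :=
  match e with
  | Var x => s x
  | Nil => Leaf
  | Cons e1 e2 => Node (eval s e1) (eval s e2)
  | Hd e1 => tree_hd (eval s e1)
  | Tl e1 => tree_tl (eval s e1)
  end.

Fixpoint ecost (e : expr) : nat :=
  match e with
  | Var _ | Nil => 1
  | Cons e1 e2 => (ecost e1 + ecost e2).+1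
  | Hd e1 | Tl e1 => (ecost e1).+1
  end.

(** [exec c s t s']: from store [s], [c] halts in store [s'] at total cost
    [t]. *)
Inductive exec : com -> store -> nat -> store -> Prop :=
  | exec_assign x e s :
      exec (Assign x e) s (ecost e).+1 (upd s x (eval s e))
  | exec_seq c1 c2 s t1 s1 t2 s2 :
      exec c1 s t1 s1 -> exec c2 s1 t2 s2 ->
      exec (Seq c1 c2) s (t1 + t2) s2
  | exec_if_true e c1 c2 s t s1 :
      eval s e <> Leaf -> exec c1 s t s1 ->
      exec (If e c1 c2) s ((ecost e).+1 + t) s1
  | exec_if_false e c1 c2 s t s1 :
      eval s e = Leaf -> exec c2 s t s1 ->
      exec (If e c1 c2) s ((ecost e).+1 + t) s1
  | exec_while_true e c s t1 s1 t2 s2 :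
      eval s e <> Leaf -> exec c s t1 s1 -> exec (While e c) s1 t2 s2 ->
      exec (While e c) s ((ecost e).+1 + t1 + t2) s2
  | exec_while_false e c s :
      eval s e = Leaf -> exec (While e c) s (ecost e).+1 s.

(** Variable 0 carries the input and the output; all other variables are
    initially [Leaf]. *)
Definition runs (p : com) (x : tree) (t : nat) (y : tree) : Prop :=
  exists s : store, exec p (upd (fun=> Leaf) 0 x) t s /\ s 0 = y.

(** [p] answers every instance of the class [dom] correctly ([Leaf] means "no")
    and within the time bound [T]; nothing is required outside [dom]. *)
Definition solves_in_time (R : realType) (I : Type) (enc : I -> tree)
    (dom yes : I -> Prop) (T : I -> R) (p : com) : Prop :=
  forall i, dom i ->
    exists t y, [/\ runs p (enc i) t y, y <> Leaf <-> yes i & (t%:R <= T i)%R].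

Definition enc_nat (n : nat) : tree := iter n (Node Leaf) Leaf.

Definition enc_bool (b : bool) : tree := if b then Node Leaf Leaf else Leaf.

Definition enc_seq (A : Type) (enc : A -> tree) (s : seq A) : tree :=
  foldr (fun a d => Node (enc a) d) Leaf s.

(** The literal [(v, b)] is the variable [v] if [b], its negation otherwise. *)
Definition literal (n : nat) : Type := 'I_n * bool.

Record cnf := CNF { nvars : nat; clauses : seq (seq (literal nvars)) }.

Definition is_3cnf (phi : cnf) : Prop :=
  all (fun c => size c <= 3) (clauses phi).

Definition satisfiable (phi : cnf) : Prop :=
  exists a : 'I_(nvars phi) -> bool,
    all (has (fun l => a l.1 == l.2)) (clauses phi).

Definition enc_literal (n : nat) (l : literal n) : tree :=
  Node (enc_bool l.2) (enc_nat l.1).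

Definition enc_cnf (phi : cnf) : tree :=
  Node (enc_nat (nvars phi)) (enc_seq (enc_seq (@enc_literal _)) (clauses phi)).

(** Some delta > 0 is such that no algorithm solves 3-SAT on n variables in
    time 2^(delta n) |phi|^O(1). The polynomial factor in the input length is
    needed because clauses may be repeated, so |phi| is not bounded in terms of
    n. *)
Definition ETH (R : realType) : Prop :=
  exists2 delta : R, (0 < delta)%R &
    ~ exists (p : com) (C : R) (k : nat),
        solves_in_time enc_cnf is_3cnf satisfiable
          (fun phi => C * 2 `^ (delta * (nvars phi)%:R) *
                      (tree_size (enc_cnf phi))%:R ^+ k)%R p.

Record graph := Graph {
  gorder : nat;
  adj : rel 'I_gorder;
  adj_sym : symmetric adj;
  adj_irr : irreflexive adj }.

Definition vertex (G : graph) : finType := 'I_(gorder G).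

(** N(S) = N[S] \ S excludes the vertices of S. *)
Definition open_nbhd (G : graph) (S : {set vertex G}) : {set vertex G} :=
  [set v in ~: S | [exists u in S, adj u v]].

Definition deg_in (G : graph) (S : {set vertex G}) (v : vertex G) : nat :=
  #|[set u in S | adj v u]|.

Definition offensive_alliance (G : graph) (S : {set vertex G}) : Prop :=
  S != finset.set0 /\
  forall v, v \in open_nbhd S -> deg_in S v >= deg_in (~: S) v + 1.

Definition bipartite (G : graph) : Prop :=
  exists A : {set vertex G},
    forall u v : vertex G, adj u v -> (u \in A) != (v \in A).

Definition has_offensive_alliance (i : graph * nat) : Prop :=
  exists S : {set vertex i.1}, offensive_alliance S /\ 1 <= #|S| <= i.2.

Definition enc_graph (G : graph) : tree :=
  enc_seq (enc_seq enc_bool)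
    [seq [seq adj u v | v <- enum (vertex G)] | u <- enum (vertex G)].

Definition enc_instance (i : graph * nat) : tree :=
  Node (enc_graph i.1) (enc_nat i.2).

Local Open Scope classical_set_scope.

(** The time bound 2^(f n), f = o(n), depends on the number n of vertices
    alone, not on [i.2]. *)
Definition OA_subexponential (R : realType) (class : graph -> Prop) : Prop :=
  exists (p : com) (f : nat -> R),
    (f =o_\oo (fun n => n%:R : R))%R /\
    solves_in_time enc_instance (fun i => class i.1 /\ 1 <= i.2)
      has_offensive_alliance (fun i => 2 `^ (f (gorder i.1)))%R p.

(* Main.v *)
(** Sparsification: branching on a set of at most two literals shared by many
    clauses (one of its literals is true, or each of the clauses is satisfied
    outside it) reduces a 3-CNF on [n] variables to [2 ^ (e n)] formulas with
    [O(n)] clauses each. The number of leaves is bounded by the weight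
    [al ^ u * be ^ v], where [u] literals are not yet forced and at most [v]
    2-clauses can still be added: heart branches decrease the weight only
    slightly, petal branches by a large factor, and a suitable choice of the
    thresholds makes the two weights add up to at most the original one while
    [al] and [be] are as close to 1 as wanted.

    A sparse formula becomes a bipartite graph with [O(n)] vertices: two hubs and
    the literals face the clauses and one pair clause per variable. A clause
    outside an alliance that contains the hubs has a majority of its neighbours
    inside exactly when one of its literals is inside; the hubs are forced by
    their large degree, and the size bound leaves room for one literal per
    variable, so alliances are satisfying assignments. *)

Require Import Defs.
From mathcomp Require Import all_boot all_order all_algebra.
From mathcomp Require Import all_classical all_reals all_analysis.
From mathcomp Require Import zify ring lra.
From mathcomp Require Import seq fintype finset. (* shadowed by [all_classical] *)
Import Defs.
Import Order.TTheory GRing.Theory Num.Theory.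
Import numFieldNormedType.Exports.

Set Implicit Arguments.
Unset Strict Implicit.
Unset Printing Implicit Defensive.

(** * WHILE programs as subroutines *)

(** This is a Turing reduction: one formula yields exponentially many alliance instances, so the
    3-SAT algorithm is an explicit program that walks through the branching tree with a stack and
    calls the given program [p] at the leaves. All that is known of [p] is its behaviour from a
    fresh store, hence the calculus of subroutines and polynomial-time functions. The exponent
    [delta] is split in halves. With [al = 2 ^ (delta / 8)] and [be ^ (4 th) = al], the root has
    weight [al ^ (2 (n + 1)) * be ^ (8 th (n + 1)) = 2 ^ (delta (n + 1) / 2)], which bounds the
    number of leaves; the other half pays for one call of [p] on a graph with [O(n)] vertices. The
    obstacle in counting leaves is that the number of active 2-clauses is not monotone: branches add
    them and units deactivate them. Hence the potential, in which every unit pays in advance for the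
    pairs that it deactivates. Two fresh variables are added: one expresses an empty clause, the
    other pads unit clauses, on which the alliance gadget fails. *)

Fixpoint eshift k e :=
  match e with
  | Var x => Var (k + x)
  | Nil => Nil
  | Cons e1 e2 => Cons (eshift k e1) (eshift k e2)
  | Hd e1 => Hd (eshift k e1)
  | Tl e1 => Tl (eshift k e1)
  end.

Fixpoint cshift k c :=
  match c with
  | Assign x e => Assign (k + x) (eshift k e)
  | Seq c1 c2 => Seq (cshift k c1) (cshift k c2)
  | If e c1 c2 => If (eshift k e) (cshift k c1) (cshift k c2)
  | While e c1 => While (eshift k e) (cshift k c1)
  end.

Fixpoint evars e :=
  match e with
  | Var x => x.+1
  | Nil => 0
  | Cons e1 e2 => maxn (evars e1) (evars e2)
  | Hd e1 | Tl e1 => evars e1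
  end.

Fixpoint cvars c :=
  match c with
  | Assign x e => maxn x.+1 (evars e)
  | Seq c1 c2 => maxn (cvars c1) (cvars c2)
  | If e c1 c2 => maxn (evars e) (maxn (cvars c1) (cvars c2))
  | While e c1 => maxn (evars e) (cvars c1)
  end.

Lemma ecost_shift k e : ecost (eshift k e) = ecost e.
Proof. by elim: e => //= [e1 -> e2 ->|e ->|e ->]. Qed.

Lemma eval_shift k m e (s s' : store) :
  evars e <= m -> (forall i, i < m -> s' (k + i) = s i) ->
  eval s' (eshift k e) = eval s e.
Proof.
move=> + hs; elim: e => [x|//|e1 IH1 e2 IH2|e IH|e IH] /= he.
- exact: hs.
- by move: he; rewrite geq_max => /andP[/IH1 -> /IH2 ->].
- by rewrite IH.
- by rewrite IH.
Qed.

Definition agree k m (s s' : store) := forall i, i < m -> s' (k + i) = s i.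

Lemma exec_shift k m c s t s1 : exec c s t s1 -> cvars c <= m ->
  forall s', agree k m s s' ->
  exists s1', [/\ exec (cshift k c) s' t s1', agree k m s1 s1' &
                  forall i, i < k -> s1' i = s' i].
Proof.
elim=> {c s t s1} /=.
- move=> x e s; rewrite geq_max => /andP[hx he] s' hs.
  exists (upd s' (k + x) (eval s' (eshift k e))); split.
  + by rewrite -(ecost_shift k e); exact: exec_assign.
  + move=> i hi; rewrite /upd eqn_add2l (eval_shift he hs).
    by case: eqP => // _; exact: hs.
  + by move=> i hi; rewrite /upd; case: eqP => //; lia.
- move=> c1 c2 s t1 s1 t2 s2 _ IH1 _ IH2; rewrite geq_max => /andP[h1 h2] s' hs.
  have [s1' [e1 a1 f1]] := IH1 h1 _ hs.
  have [s2' [e2 a2 f2]] := IH2 h2 _ a1.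
  exists s2'; split=> //; first exact: exec_seq e1 e2.
  by move=> i hi; rewrite f2 // f1.
- move=> e c1 c2 s t s1 he _ IH; rewrite !geq_max => /and3P[h0 h1 h2] s' hs.
  have [s1' [e1 a1 f1]] := IH h1 _ hs; exists s1'; split=> //.
  by rewrite -(ecost_shift k e); apply: exec_if_true => //; rewrite (eval_shift h0 hs).
- move=> e c1 c2 s t s1 he _ IH; rewrite !geq_max => /and3P[h0 h1 h2] s' hs.
  have [s1' [e1 a1 f1]] := IH h2 _ hs; exists s1'; split=> //.
  by rewrite -(ecost_shift k e); apply: exec_if_false => //; rewrite (eval_shift h0 hs).
- move=> e c s t1 s1 t2 s2 he _ IH1 _ IH2; rewrite geq_max => /andP[h0 h1] s' hs.
  have [s1' [e1 a1 f1]] := IH1 h1 _ hs.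
  have [|s2' [e2 a2 f2]] := IH2 _ _ a1; first by rewrite geq_max h0.
  exists s2'; split=> //.
    rewrite -(ecost_shift k e); apply: exec_while_true e1 e2.
    by rewrite (eval_shift h0 hs).
  by move=> i hi; rewrite f2 // f1.
- move=> e c s he; rewrite geq_max => /andP[h0 h1] s' hs.
  exists s'; split=> //.
  rewrite -(ecost_shift k e); apply: exec_while_false.
  by rewrite (eval_shift h0 hs).
Qed.

(** Variable [k] is spared because it holds the argument of the subroutine; the base case is a
    no-op, the language having no skip. *)
Fixpoint clear_vars k m :=
  if m is m'.+1 then Seq (Assign (k + m) Nil) (clear_vars k m')
  else Assign k (Var k).

Lemma exec_clear k m s : exists s', [/\ exec (clear_vars k m) s (2 * m.+1) s',
  s' k = s k, forall i, 0 < i <= m -> s' (k + i) = Leaf,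
  forall i, i < k -> s' i = s i & forall i, k + m < i -> s' i = s i].
Proof.
elim: m s => [|m IH] s /=.
  exists (upd s k (s k)); split.
  - exact: (exec_assign k (Var k) s).
  - by rewrite /upd eqxx.
  - by move=> i; lia.
  - by move=> i hi; rewrite /upd; case: eqP => //; lia.
  - by move=> i hi; rewrite /upd; case: eqP => //; lia.
have [s' [e1 e2 e3 e4 e5]] := IH (upd s (k + m.+1) Leaf).
exists s'; split.
- rewrite [X in exec _ _ X _](_ : _ = 2 + 2 * m.+1); last by lia.
  by apply: exec_seq e1; exact: (exec_assign _ Nil s).
- by rewrite e2 /upd; case: eqP => //; lia.
- move=> i hi.
  have [him|] := leqP i m; first by apply: e3; lia.
  move=> him; have -> : i = m.+1 by lia.
  by rewrite e5 /upd ?eqxx //; lia.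
- by move=> i hi; rewrite e4 // /upd; case: eqP => //; lia.
- by move=> i hi; rewrite e5 /upd; [case: eqP => //; lia|lia].
Qed.

(* Restoring the initial contents [Leaf] of the variables of [p] makes [p]
   usable as a subroutine, any number of times and from any store. *)
Definition subroutine k p := Seq (clear_vars k (cvars p)) (cshift k p).

Lemma exec_subroutine p x t y k s : runs p x t y -> s k = x ->
  exists s', [/\ exec (subroutine k p) s (2 * (cvars p).+1 + t) s', s' k = y &
                 forall i, i < k -> s' i = s i].
Proof.
move=> [s1 [hex hy]] hx.
have [s2 [e1 e2 e3 e4 _]] := exec_clear k (cvars p) s.
have [|s3 [f1 f2 f3]] := exec_shift hex (leqnSn (cvars p)) (k := k) (s' := s2).
  move=> i hi; rewrite /upd; case: eqP => [->|hi0]; first by rewrite addn0 e2 hx.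
  by rewrite e3 //; lia.
exists s3; split; first exact: exec_seq e1 f1.
- by rewrite -(addn0 k) f2.
- by move=> i hi; rewrite f3 // e4.
Qed.

(** The base is at least 2 for every [n], so that larger exponents absorb constants and sums. *)
Definition poly_bounded (g : nat -> nat) := exists k, forall n, g n <= n.+2 ^ k.

Lemma pb_const c : poly_bounded (fun=> c).
Proof.
exists c => n; apply: leq_trans (ltnW (ltn_expl c (isT : 1 < 2))) _.
by case: c => // c; rewrite leq_exp2r.
Qed.

Lemma pb_id : poly_bounded id.
Proof. by exists 1 => n; rewrite expn1; lia. Qed.

Lemma pb_exp k : poly_bounded (fun n => n.+2 ^ k).
Proof. by exists k. Qed.

Lemma pb_le f g : poly_bounded g -> (forall n, f n <= g n) -> poly_bounded f.
Proof. by move=> [k hk] h; exists k => n; apply: leq_trans (hk n). Qed.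

Lemma pb_mul f g : poly_bounded f -> poly_bounded g -> poly_bounded (fun n => f n * g n).
Proof. by move=> [k hk] [l hl]; exists (k + l) => n; rewrite expnD leq_mul. Qed.

Lemma pb_add f g : poly_bounded f -> poly_bounded g -> poly_bounded (fun n => f n + g n).
Proof.
move=> hf hg.
apply: (@pb_le _ (fun n => 2 * ((f n).+1 * (g n).+1))); last by move=> n; nia.
have pbS h : poly_bounded h -> poly_bounded (fun n => (h n).+1).
  move=> [k hk]; exists k.+1 => n; rewrite expnS.
  have h0 : 0 < n.+2 ^ k by rewrite expn_gt0.
  have := hk n; nia.
by apply: pb_mul (pb_const 2) (pb_mul _ _); exact: pbS.
Qed.

Lemma pb_comp f k : poly_bounded f -> poly_bounded (fun n => (f n).+2 ^ k).
Proof.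
move=> [l hl]; exists ((l + 2) * k) => n; rewrite expnM.
have [->|k0] := posnP k; first by rewrite !expn0.
rewrite leq_exp2r // expnD.
have h0 : 0 < n.+2 ^ l by rewrite expn_gt0.
have := hl n; nia.
Qed.

Ltac pbt := repeat first
  [ exact: pb_id | exact: pb_const | exact: pb_exp | assumption
  | apply: pb_comp | apply: pb_mul | apply: pb_add ].

(** * Polynomial-time functions *)

Class Enc (A : Type) := enc : A -> tree.

#[global] Instance Enc_nat : Enc nat := enc_nat.
#[global] Instance Enc_bool : Enc bool := enc_bool.
#[global] Instance Enc_seq A {EA : Enc A} : Enc (seq A) := enc_seq enc.
#[global] Instance Enc_pair A B {EA : Enc A} {EB : Enc B} : Enc (A * B) :=
  fun x => Node (enc x.1) (enc x.2).

Definition esize A {EA : Enc A} (a : A) := tree_size (enc a).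
Arguments esize : simpl never.

Lemma esize_gt0 A {EA : Enc A} (a : A) : 0 < esize a.
Proof. by rewrite /esize; case: (enc a). Qed.

Lemma esize_pair A B {EA : Enc A} {EB : Enc B} (x : A * B) :
  esize x = (esize x.1 + esize x.2).+1.
Proof. by []. Qed.

Lemma esize_nil A {EA : Enc A} : esize ([::] : seq A) = 1.
Proof. by []. Qed.

Lemma esize_cons A {EA : Enc A} a (s : seq A) :
  esize (a :: s) = (esize a + esize s).+1.
Proof. by []. Qed.

Lemma esize_bool (b : bool) : esize b <= 3.
Proof. by case: b. Qed.

Lemma esize_nat (n : nat) : esize n = (2 * n).+1.
Proof. by elim: n => //= n IH; rewrite /esize /= -/(esize n) IH; lia. Qed.

Lemma esize_cat A {EA : Enc A} (s1 s2 : seq A) :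
  esize (s1 ++ s2) = (esize s1 + esize s2).-1.
Proof.
elim: s1 => [|a s1 IH]; first by rewrite cat0s esize_nil add1n.
rewrite cat_cons !esize_cons IH; have h0 : 0 < esize s1 by exact: esize_gt0.
lia.
Qed.

Lemma size_esize A {EA : Enc A} (s : seq A) : size s <= esize s.
Proof. by elim: s => //= a s IH; rewrite esize_cons; lia. Qed.

Lemma esize_le A {EA : Enc A} (s : seq A) m :
  all (fun a => esize a <= m) s -> esize s <= (size s * m.+1).+1.
Proof.
elim: s => //= a s IH /andP[h1 h2]; rewrite esize_cons mulSn.
by have := IH h2; lia.
Qed.

Lemma esize_subseq (A : eqType) {EA : Enc A} (s1 s2 : seq A) :
  subseq s1 s2 -> esize s1 <= esize s2.
Proof.
elim: s2 s1 => [|b s2 IH] s1; first by rewrite subseq0 => /eqP ->.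
case: s1 => [|a s1]; first by rewrite esize_nil esize_gt0.
by rewrite /= !esize_cons; case: eqP => [->|_] /IH; rewrite ?esize_cons; lia.
Qed.

(* The code is parametrized by the index of the variable that holds the input
   and then the output; it may overwrite the variables above that one only. *)
Definition polytime A B {EA : Enc A} {EB : Enc B} (f : A -> B) :=
  exists (c : nat -> com) (k : nat), forall j a s, s j = enc a ->
    exists t s', [/\ exec (c j) s t s', s' j = enc (f a),
      forall i, i < j -> s' i = s i, t <= (esize a).+2 ^ k &
      esize (f a) <= (esize a).+2 ^ k].

Lemma polytimeI A B {EA : Enc A} {EB : Enc B} (f : A -> B) c g1 g2 :
  poly_bounded g1 -> poly_bounded g2 ->
  (forall j a s, s j = enc a ->
    exists t s', [/\ exec (c j) s t s', s' j = enc (f a),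
      forall i, i < j -> s' i = s i, t <= g1 (esize a) &
      esize (f a) <= g2 (esize a)]) ->
  polytime f.
Proof.
move=> h1 h2 H; have [k hk] := pb_add h1 h2.
exists c, k => j a s /H[t [s' [e1 e2 e3 e4 e5]]].
by exists t, s'; split=> //; apply: leq_trans (hk _); lia.
Qed.

Lemma eq_polytime A B {EA : Enc A} {EB : Enc B} (f g : A -> B) :
  polytime f -> f =1 g -> polytime g.
Proof.
move=> [c [k h]] fg; exists c, k => j a s /h[t [s' H]].
by exists t, s'; rewrite -fg.
Qed.

(** A program sees only trees, so it also computes any function with the same encoded arguments and
    values. This identifies pairs with non-empty lists, and unary numbers with lists of units. *)
Lemma polytime_recode A A' B B' {EA : Enc A} {EB : Enc B} {EA' : Enc A'} {EB' : Enc B'}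
    (f : A -> B) (f' : A' -> B') (h : A' -> A) :
  (forall a, enc a = enc (h a)) -> (forall a, enc (f' a) = enc (f (h a))) ->
  polytime f -> polytime f'.
Proof.
move=> ha hf [c [k H]]; exists c, k => j a s; rewrite ha => /H[t [s' [e1 e2 e3 e4 e5]]].
exists t, s'; rewrite hf; split=> //.
- by rewrite /esize ha.
- by rewrite /esize ha hf.
Qed.

Ltac upd_simp := rewrite /upd; repeat (case: eqP => //=; try lia).

Lemma polytime_assign A B {EA : Enc A} {EB : Enc B} (f : A -> B) (e : nat -> expr) m g :
  poly_bounded g -> (forall a, esize (f a) <= g (esize a)) ->
  (forall j, ecost (e j) <= m) ->
  (forall j s a, s j = enc a -> eval s (e j) = enc (f a)) -> polytime f.
Proof.
move=> hg hf hm he.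
apply: (@polytimeI _ _ _ _ f (fun j => Assign j (e j)) _ _ (pb_const m.+1) hg).
move=> j a s hs; exists (ecost (e j)).+1, (upd s j (eval s (e j))); split=> //.
- exact: exec_assign.
- by rewrite /upd eqxx (he _ _ _ hs).
- by move=> i hi; upd_simp.
- by rewrite ltnS hm.
Qed.

Lemma polytime_id A {EA : Enc A} : polytime (fun a : A => a).
Proof.
by apply: (@polytime_assign _ _ _ _ _ Var 1 id) => //=; exact: pb_id.
Qed.

Fixpoint tree_expr (d : tree) : expr :=
  if d is Node l r then Cons (tree_expr l) (tree_expr r) else Nil.

Lemma polytime_const A B {EA : Enc A} {EB : Enc B} (b : B) : polytime (fun _ : A => b).
Proof.
apply: (@polytime_assign _ _ _ _ _ (fun=> tree_expr (enc b))
  (ecost (tree_expr (enc b))) (fun=> esize b)) => //; first exact: pb_const.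
by move=> _ s _ _; elim: (enc b) => //= l -> r ->.
Qed.

Lemma polytime_comp A B C {EA : Enc A} {EB : Enc B} {EC : Enc C} (f : A -> B) (g : B -> C) :
  polytime f -> polytime g -> polytime (fun a => g (f a)).
Proof.
move=> [cf [k hf]] [cg [l hg]].
have pb1 : poly_bounded (fun n => n.+2 ^ k + (n.+2 ^ k).+2 ^ l) by pbt.
apply: (@polytimeI _ _ _ _ _ (fun j => Seq (cf j) (cg j)) _ _ pb1 pb1).
move=> j a s /hf[t [s' [e1 e2 e3 e4 e5]]].
have [t' [s'' [e1' e2' e3' e4' e5']]] := hg _ _ _ e2.
have hle : (esize (f a)).+2 ^ l <= ((esize a).+2 ^ k).+2 ^ l.
  by case: (l) => // l'; rewrite leq_exp2r.
exists (t + t'), s''; split=> //.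
- exact: exec_seq e1 e1'.
- by move=> i hi; rewrite e3' // e3.
- by rewrite leq_add // (leq_trans e4').
- by rewrite (leq_trans e5') // (leq_trans hle) // leq_addl.
Qed.

Lemma polytime_pair A B C {EA : Enc A} {EB : Enc B} {EC : Enc C} (f : A -> B) (g : A -> C) :
  polytime f -> polytime g -> polytime (fun a => (f a, g a)).
Proof.
move=> [cf [k hf]] [cg [l hg]].
have pb1 : poly_bounded (fun n => n.+2 ^ k + n.+2 ^ l + 10) by pbt.
apply: (@polytimeI _ _ _ _ _ (fun j => Seq (Assign j.+1 (Var j)) (Seq (cf j.+1)
  (Seq (Assign j.+2 (Var j)) (Seq (cg j.+2)
    (Assign j (Cons (Var j.+1) (Var j.+2))))))) _ _ pb1 pb1).
move=> j a s hs.
have [|t1 [s1 [e1 e2 e3 e4 e5]]] := hf j.+1 a (upd s j.+1 (s j)).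
  by rewrite /upd eqxx.
have [|t2 [s2 [f1 f2 f3 f4 f5]]] := hg j.+2 a (upd s1 j.+2 (s1 j)).
  by rewrite /upd eqxx e3 // -hs; upd_simp.
exists (2 + (t1 + (2 + (t2 + 4)))), (upd s2 j (Node (s2 j.+1) (s2 j.+2))); split.
- apply: exec_seq; first exact: (exec_assign _ (Var j)).
  apply: exec_seq e1 _.
  apply: exec_seq; first exact: (exec_assign _ (Var j)).
  apply: exec_seq f1 _.
  exact: (exec_assign j (Cons (Var j.+1) (Var j.+2))).
- rewrite /upd eqxx f2 f3 // -/(upd s1 j.+2 (s1 j) j.+1).
  by rewrite {1}/upd (_ : (j.+1 == j.+2) = false) ?e2 //; lia.
- move=> i hi; rewrite /upd; case: eqP; first lia.
  move=> _; rewrite f3; last lia.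
  by rewrite /upd; case: eqP; [lia|move=> _]; rewrite e3; [upd_simp|lia].
- lia.
- rewrite esize_pair /=; lia.
Qed.

Lemma polytime_fst A B C {EA : Enc A} {EB : Enc B} {EC : Enc C} (f : A -> B * C) :
  polytime f -> polytime (fun a => (f a).1).
Proof.
move=> hf; apply: polytime_comp hf _.
apply: (@polytime_assign _ _ _ _ _ (fun j => Hd (Var j)) 2 id) => //=; first exact: pb_id.
- by move=> a; rewrite esize_pair; lia.
- by move=> j s a ->.
Qed.

Lemma polytime_snd A B C {EA : Enc A} {EB : Enc B} {EC : Enc C} (f : A -> B * C) :
  polytime f -> polytime (fun a => (f a).2).
Proof.
move=> hf; apply: polytime_comp hf _.
apply: (@polytime_assign _ _ _ _ _ (fun j => Tl (Var j)) 2 id) => //=; first exact: pb_id.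
- by move=> a; rewrite esize_pair; lia.
- by move=> j s a ->.
Qed.

Lemma polytime_cons A B {EA : Enc A} {EB : Enc B} (f : A -> B) (g : A -> seq B) :
  polytime f -> polytime g -> polytime (fun a => f a :: g a).
Proof.
move=> hf hg; have := polytime_pair hf hg.
by apply: polytime_recode (fun a => a) _ _.
Qed.

Lemma polytime_behead A B {EA : Enc A} {EB : Enc B} (f : A -> seq B) :
  polytime f -> polytime (fun a => behead (f a)).
Proof.
move=> hf; apply: polytime_comp hf _.
apply: (@polytime_assign _ _ _ _ _ (fun j => Tl (Var j)) 2 id) => //=; first exact: pb_id.
- by case=> // b s; rewrite esize_cons /=; lia.
- by move=> j s a ->; case: a.
Qed.

Lemma polytime_if A B {EA : Enc A} {EB : Enc B} (b : A -> bool) (f g : A -> B) :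
  polytime b -> polytime f -> polytime g ->
  polytime (fun a => if b a then f a else g a).
Proof.
move=> [cb [kb hb]] [cf [k hf]] [cg [l hg]].
have pb1 : poly_bounded (fun n => n.+2 ^ kb + n.+2 ^ k + n.+2 ^ l + 10) by pbt.
apply: (@polytimeI _ _ _ _ _ (fun j => Seq (Assign j.+1 (Var j)) (Seq (cb j.+1)
  (If (Var j.+1) (cf j) (cg j)))) _ _ pb1 pb1).
move=> j a s hs.
have [|t1 [s1 [e1 e2 e3 e4 e5]]] := hb j.+1 a (upd s j.+1 (s j)).
  by rewrite /upd eqxx.
have hs1 : s1 j = enc a by rewrite e3 // -hs; upd_simp.
have hi1 i : i < j -> s1 i = s i by move=> hi; rewrite e3; [upd_simp|lia].
have ex0 : exec (Assign j.+1 (Var j)) s 2 (upd s j.+1 (s j)) by exact: (exec_assign _ (Var j)).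
case hba: (b a) e2 => e2.
- have [t2 [s2 [f1 f2 f3 f4 f5]]] := hf _ _ _ hs1.
  exists (2 + (t1 + (2 + t2))), s2; split=> //.
  + apply: exec_seq ex0 _; apply: exec_seq e1 _.
    by apply: (@exec_if_true (Var j.+1)) => //=; rewrite e2.
  + by move=> i hi; rewrite f3 // hi1.
  + lia.
  + lia.
- have [t2 [s2 [f1 f2 f3 f4 f5]]] := hg _ _ _ hs1.
  exists (2 + (t1 + (2 + t2))), s2; split=> //.
  + apply: exec_seq ex0 _; apply: exec_seq e1 _.
    by apply: (@exec_if_false (Var j.+1)) => //=; rewrite e2.
  + by move=> i hi; rewrite f3 // hi1.
  + lia.
  + lia.
Qed.

Lemma polytime_nilp A B {EA : Enc A} {EB : Enc B} (f : A -> seq B) :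
  polytime f -> polytime (fun a => nilp (f a)).
Proof.
move=> hf; apply: polytime_comp hf _.
have pb1 : poly_bounded (fun=> 10) by exact: pb_const.
apply: (@polytimeI _ _ _ _ _ (fun j => If (Var j) (Assign j Nil) (Assign j (Cons Nil Nil))) _ _ pb1 pb1).
move=> j [|b l] s hs.
- exists (2 + 4), (upd s j (Node Leaf Leaf)); split=> //.
  + apply: (@exec_if_false (Var j)) => //=; exact: (exec_assign _ (Cons Nil Nil)).
  + by rewrite /upd eqxx.
  + by move=> i hi; upd_simp.
- exists (2 + 2), (upd s j Leaf); split=> //.
  + apply: (@exec_if_true (Var j)) => //=; first by rewrite hs.
    exact: (exec_assign _ Nil).
  + by rewrite /upd eqxx.
  + by move=> i hi; upd_simp.
Qed.

(** Most list operations below reduce to this one. The bound [g] on the accumulators of all prefixes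
    is a hypothesis because a polynomial-time [step] could, for instance, double the size of the
    accumulator in each round. *)
Lemma polytime_foldl G A B {EG : Enc G} {EA : Enc A} {EB : Enc B}
    (step : G -> A -> B -> B) (l : G -> seq A) (b : G -> B) g :
  polytime (fun x : G * A * B => step x.1.1 x.1.2 x.2) ->
  polytime l -> polytime b -> poly_bounded g ->
  (forall x s1 s2, l x = s1 ++ s2 ->
     esize (foldl (fun b a => step x a b) (b x) s1) <= g (esize x)) ->
  polytime (fun x => foldl (fun b a => step x a b) (b x) (l x)).
Proof.
move=> [cs [ks hs]] [cl [kl hl]] [cb [kb hb]] pbg hg.
(* One round: bookkeeping within 20, plus the step on a parameter, a list element and an
   accumulator, with 2 for the two pair nodes. *)
pose it n := 20 + (n + n.+2 ^ kl + g n + 2).+2 ^ ks.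
have pb1 : poly_bounded (fun n => n.+2 ^ kl + n.+2 ^ kb + n.+2 ^ kl * it n + 20).
  by rewrite /it; pbt.
(* Variable [j] keeps the parameter, [j.+1] the rest of the list and [j.+2] the accumulator; the
   step runs at [j.+3]. *)
pose body j := Seq (Assign j.+3 (Cons (Cons (Var j) (Hd (Var j.+1))) (Var j.+2)))
  (Seq (Assign j.+1 (Tl (Var j.+1))) (Seq (cs j.+3) (Assign j.+2 (Var j.+3)))).
apply: (@polytimeI _ _ _ _ _ (fun j => Seq (Assign j.+1 (Var j)) (Seq (cl j.+1)
  (Seq (Assign j.+2 (Var j)) (Seq (cb j.+2) (Seq (While (Var j.+1) (body j))
  (Assign j (Var j.+2))))))) _ _ pb1 pbg).
move=> j x s hx.
have [|t1 [s1 [e1 e2 e3 e4 e5]]] := hl j.+1 x (upd s j.+1 (s j)).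
  by rewrite /upd eqxx.
have hs1 : s1 j = enc x by rewrite e3 // -hx; upd_simp.
have hi1 i : i < j -> s1 i = s i by move=> hi; rewrite e3; [upd_simp|lia].
have [|t2 [s2 [f1 f2 f3 f4 f5]]] := hb j.+2 x (upd s1 j.+2 (s1 j)).
  by rewrite /upd eqxx.
have hs2 : s2 j = enc x by rewrite f3 // -hs1; upd_simp.
have hs21 : s2 j.+1 = enc (l x) by rewrite f3 // -e2; upd_simp.
have hi2 i : i < j -> s2 i = s i.
  by move=> hi; rewrite f3; [rewrite -hi1 //; upd_simp|lia].
have loop : forall r p s2, l x = p ++ r -> s2 j = enc x -> s2 j.+1 = enc r ->
  s2 j.+2 = enc (foldl (fun b a => step x a b) (b x) p) ->
  exists t3 s3, [/\ exec (While (Var j.+1) (body j)) s2 t3 s3,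
    s3 j.+2 = enc (foldl (fun b a => step x a b) (b x) (l x)),
    forall i, i < j -> s3 i = s2 i & t3 <= 2 + size r * it (esize x)].
  elim=> [|a r IH] p q hp q0 q1 q2.
    exists 2, q; split=> //; last by rewrite q2 hp cats0.
    by apply: (@exec_while_false (Var j.+1)); rewrite /= q1.
  set acc := foldl _ _ p in q2.
  pose q' := upd (upd q j.+3 (Node (Node (q j) (@enc A EA a)) (q j.+2))) j.+1
    (@enc (seq A) (@Enc_seq A EA) r).
  have [|t3 [q3 [g1 g2 g3 g4 g5]]] := hs j.+3 (x, a, acc) q'.
    by rewrite /q' q0 q2; upd_simp.
  pose q4 := upd q3 j.+2 (q3 j.+3).
  have [||||t5 [q5 [h1 h2 h3 h4]]] := IH (rcons p a) q4.
  - by rewrite hp cat_rcons.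
  - by rewrite /q4 {1}/upd ltn_eqF; [rewrite g3; [rewrite -q0 /q'; upd_simp|lia]|lia].
  - by rewrite /q4 {1}/upd ltn_eqF; [rewrite g3; [rewrite /q'; upd_simp|lia]|lia].
  - by rewrite /q4 /upd eqxx g2 foldl_rcons.
  have hq i : i < j -> q4 i = q i.
    move=> hi; rewrite /q4 {1}/upd ltn_eqF; last lia.
    by rewrite g3; [rewrite /q'; upd_simp|lia].
  exists (2 + (7 + (3 + (t3 + 2))) + t5), q5; split=> //.
  + apply: (@exec_while_true (Var j.+1)) h1; first by rewrite /= q1.
    apply: exec_seq; first exact: (exec_assign _ (Cons (Cons (Var j) (Hd (Var j.+1))) (Var j.+2))).
    apply: exec_seq; first exact: (exec_assign _ (Tl (Var j.+1))).
    apply: exec_seq; last exact: (exec_assign j.+2 (Var j.+3)).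
    move: g1; congr (exec _ _ _ _); rewrite /q' /= q1 /=.
    by congr (upd _ _ _); rewrite /upd; case: eqP; rewrite ?q1 //; lia.
  + by move=> i hi; rewrite h3 // hq.
  + have hsz : t3 <= it (esize x) - 20.
      apply: leq_trans g4 _; rewrite /it addKn.
      case: (ks) => // ks'; rewrite leq_exp2r // !esize_pair /= !ltnS.
      have := hg x p (a :: r) hp; rewrite -/acc.
      have := hl j.+1 x (upd s j.+1 (s j)); rewrite {1}/upd eqxx => /(_ hx).
      move=> [_ [_ [_ _ _ _]]].
      rewrite hp esize_cat esize_cons.
      have h0 : 0 < esize p by exact: esize_gt0.
      lia.
    rewrite /= mulSn; move: h4 hsz; set I := it _.
    have : 20 <= I by rewrite /I /it; lia.
    lia.
have [//|t3 [s3 [g1 g2 g3 g4]]] := loop (l x) [::] s2 erefl hs2 hs21.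
exists (2 + (t1 + (2 + (t2 + (t3 + 2))))), (upd s3 j (s3 j.+2)); split.
- apply: exec_seq; first exact: (exec_assign _ (Var j)).
  apply: exec_seq e1 _.
  apply: exec_seq; first exact: (exec_assign _ (Var j)).
  apply: exec_seq f1 _.
  by apply: exec_seq g1 _; exact: (exec_assign j (Var j.+2)).
- by rewrite /upd eqxx.
- move=> i hi; rewrite {1}/upd ltn_eqF // g3 // hi2 //.
- have : size (l x) * it (esize x) <= (esize x).+2 ^ kl * it (esize x).
    by rewrite leq_mul2r (leq_trans (size_esize _) e5) orbT.
  lia.
- by apply: (hg _ _ [::]); rewrite cats0.
Qed.

Ltac polytime_proj := repeat
  lazymatch goal with
  | |- polytime (fun x => x) => exact: polytime_id
  | |- polytime (fun x => fst (@?f x)) => refine (polytime_fst (f := f) _); cbv beta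
  | |- polytime (fun x => snd (@?f x)) => refine (polytime_snd (f := f) _); cbv beta
  | |- polytime (fun x => @?b x) => exact: polytime_const
  | |- @polytime ?A ?B ?EA ?EB ?f => change (@polytime A B EA EB (fun x => f x))
  end.

Lemma polytime_esize A B {EA : Enc A} {EB : Enc B} (f : A -> B) :
  polytime f -> exists2 g, poly_bounded g & forall a, esize (f a) <= g (esize a).
Proof.
move=> [c [k h]]; exists (fun n => n.+2 ^ k); first by pbt.
by move=> a; have [|t [s' []]] := h 0 a (fun=> enc a).
Qed.

Lemma polytime_negb A {EA : Enc A} (f : A -> bool) :
  polytime f -> polytime (fun a => ~~ f a).
Proof.
move=> hf; apply: (@eq_polytime _ _ _ _ (fun a => if f a then false else true)).
  by apply: polytime_if => //; exact: polytime_const.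
by move=> a; case: (f a).
Qed.

Lemma polytime_andb A {EA : Enc A} (f g : A -> bool) :
  polytime f -> polytime g -> polytime (fun a => f a && g a).
Proof. by move=> hf hg; apply: polytime_if => //; exact: polytime_const. Qed.

Lemma polytime_orb A {EA : Enc A} (f g : A -> bool) :
  polytime f -> polytime g -> polytime (fun a => f a || g a).
Proof. by move=> hf hg; apply: polytime_if => //; exact: polytime_const. Qed.

Lemma polytime_has G A {EG : Enc G} {EA : Enc A} (f : G -> A -> bool) (l : G -> seq A) :
  polytime (fun x : G * A => f x.1 x.2) -> polytime l ->
  polytime (fun x => has (f x) (l x)).
Proof.
move=> hf hl; apply: (@eq_polytime _ _ _ _
  (fun x => foldl (fun b a => b || f x a) false (l x))); last first.
  move=> x; rewrite -[RHS]orFb; elim: (l x) false => [|a s IH] b /=.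
    by rewrite orbF.
  by rewrite IH orbA.
apply: (@polytime_foldl _ _ _ _ _ _ (fun x a b => b || f x a)
  l (fun=> false) (fun=> 3)) => //.
- apply: polytime_orb; first by polytime_proj.
  by refine (polytime_comp (f := fst) _ hf); polytime_proj.
- exact: polytime_const.
- exact: pb_const.
- by move=> *; exact: esize_bool.
Qed.

Lemma polytime_all G A {EG : Enc G} {EA : Enc A} (f : G -> A -> bool) (l : G -> seq A) :
  polytime (fun x : G * A => f x.1 x.2) -> polytime l ->
  polytime (fun x => all (f x) (l x)).
Proof.
move=> hf hl; apply: (@eq_polytime _ _ _ _
   (fun x => ~~ has (fun a => ~~ f x a) (l x))).
  by apply/polytime_negb/(@polytime_has _ _ _ _ (fun x a => ~~ f x a)) => //; exact: polytime_negb.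
by move=> x; rewrite -all_predC; apply: eq_all => a /=; rewrite negbK.
Qed.

Lemma esize_rev A {EA : Enc A} (s : seq A) : esize (rev s) = esize s.
Proof.
elim: s => // a s IH; rewrite rev_cons -cats1 esize_cat IH !esize_cons esize_nil.
lia.
Qed.

Lemma polytime_rev A B {EA : Enc A} {EB : Enc B} (l : A -> seq B) :
  polytime l -> polytime (fun x => rev (l x)).
Proof.
move=> hl; have hrev (s : seq B) : foldl (fun b a => a :: b) [::] s = rev s.
  rewrite -[RHS]cats0; elim: s [::] => //= a s IH r.
  by rewrite IH rev_cons cat_rcons.
have [g pbg hg] := polytime_esize hl.
apply: (@eq_polytime _ _ _ _ (fun x => foldl (fun b a => a :: b) [::] (l x))); last first.
  by move=> x; exact: hrev.
apply: (@polytime_foldl _ _ _ _ _ _ (fun x a b => a :: b) l (fun=> [::]) g) => //.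
- apply: polytime_cons; last by polytime_proj.
  by polytime_proj.
- exact: polytime_const.
- move=> x s1 s2 hx; rewrite hrev esize_rev; apply: leq_trans (hg x).
  by rewrite hx esize_cat; have : 0 < esize s2 by [exact: esize_gt0]; lia.
Qed.

Lemma polytime_cat A B {EA : Enc A} {EB : Enc B} (l r : A -> seq B) :
  polytime l -> polytime r -> polytime (fun x => l x ++ r x).
Proof.
move=> hl hr.
have hcat (s t : seq B) : foldl (fun b a => a :: b) t s = rev s ++ t.
  by elim: s t => //= a s IH t; rewrite IH rev_cons cat_rcons.
have [g pbg hg] := polytime_esize hl; have [g' pbg' hg'] := polytime_esize hr.
apply: (@eq_polytime _ _ _ _ (fun x => foldl (fun b a => a :: b) (r x) (rev (l x)))); last first.
  by move=> x; rewrite hcat revK.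
apply: (@polytime_foldl _ _ _ _ _ _ (fun x a b => a :: b) (fun x => rev (l x)) r
  (fun n => g n + g' n)) => //; last 2 first.
- by pbt.
- move=> x s1 s2 hx; rewrite hcat esize_cat esize_rev.
  have := hg x; have := hg' x; rewrite -(esize_rev (l x)) hx esize_cat.
  have : 0 < esize s2 by [exact: esize_gt0]; lia.
- apply: polytime_cons; last by polytime_proj.
  by polytime_proj.
- exact: polytime_rev.
Qed.

Lemma polytime_map G A B {EG : Enc G} {EA : Enc A} {EB : Enc B}
    (f : G -> A -> B) (l : G -> seq A) :
  polytime (fun x : G * A => f x.1 x.2) -> polytime l ->
  polytime (fun x => map (f x) (l x)).
Proof.
move=> hf hl.
have hmap x (s : seq A) : foldl (fun b a => f x a :: b) [::] s = rev (map (f x) s).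
  rewrite -[RHS]cats0; elim: s [::] => //= a s IH r.
  by rewrite IH rev_cons cat_rcons.
have [g pbg hg] := polytime_esize hl.
have hf' := hf; case: hf' => cf [k hk].
have {}hk x a : esize (f x a) <= (esize x + esize a).+3 ^ k.
  by have [|t [s' [_ _ _ _]]] := hk 0 (x, a) (fun=> enc (x, a)).
apply: (@eq_polytime _ _ _ _ (fun x => rev (foldl (fun b a => f x a :: b) [::] (l x)))); last first.
  by move=> x; rewrite hmap revK.
apply: polytime_rev.
pose bd n := (g n * ((n + g n).+1.+2 ^ k).+1).+1.
have pbbd : poly_bounded bd.
  apply: (@pb_le _ (fun n => g n * ((n + g n + 1).+2 ^ k + 1) + 1)); first by pbt.
  by move=> n; rewrite /bd !addn1.
apply: (@polytime_foldl _ _ _ _ _ _ (fun x a b => f x a :: b) l (fun=> [::]) bd) => //.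
- apply: polytime_cons; last by polytime_proj.
  by refine (polytime_comp (f := fst) _ hf); polytime_proj.
- exact: polytime_const.
- move=> x s1 s2 hx; rewrite hmap esize_rev.
  have h0 : 0 < esize s2 by exact: esize_gt0.
  have h1 : esize s1 <= g (esize x).
    by apply: leq_trans (hg x); rewrite hx esize_cat; lia.
  have hall : all (fun b => esize b <= (esize x + g (esize x)).+3 ^ k) (map (f x) s1).
    elim: s1 h1 {hx} => //= a s1 IH; rewrite esize_cons => h1.
    rewrite IH ?andbT; last by lia.
    apply: leq_trans (hk x a) _; case: (k) => // k'; rewrite leq_exp2r //.
    by rewrite !ltnS leq_add2l; lia.
  apply: leq_trans (esize_le hall) _; rewrite size_map /bd ltnS leq_mul2r.
  by rewrite (leq_trans (size_esize s1) h1) orbT.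
Qed.

Lemma polytime_flatten A B {EA : Enc A} {EB : Enc B} (l : A -> seq (seq B)) :
  polytime l -> polytime (fun x => flatten (l x)).
Proof.
move=> hl; have hfl (s : seq (seq B)) : foldl (fun b a => b ++ a) [::] s = flatten s.
  rewrite -[RHS]cat0s; elim: s [::] => /= [|a s IH] r; first by rewrite cats0.
  by rewrite IH catA.
have hsz (s : seq (seq B)) : esize (flatten s) <= esize s.
  elim: s => [|a s IH]; first by rewrite !esize_nil.
  by rewrite esize_cons /= esize_cat; lia.
have [g pbg hg] := polytime_esize hl.
apply: (@eq_polytime _ _ _ _ (fun x => foldl (fun b a => b ++ a) [::] (l x))); last first.
  by move=> x; exact: hfl.
apply: (@polytime_foldl _ _ _ _ _ _ (fun x a b => b ++ a) l (fun=> [::]) g) => //.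
- by apply: polytime_cat; polytime_proj.
- exact: polytime_const.
- move=> x s1 s2 hx; rewrite hfl; apply: leq_trans (hg x); apply: leq_trans (hsz _) _.
  rewrite hx esize_cat.
  have : 0 < esize s2 by [exact: esize_gt0]; lia.
Qed.

Lemma polytime_filter G A {EG : Enc G} {EA : Enc A} (f : G -> A -> bool) (l : G -> seq A) :
  polytime (fun x : G * A => f x.1 x.2) -> polytime l ->
  polytime (fun x => filter (f x) (l x)).
Proof.
move=> hf hl; apply: (@eq_polytime _ _ _ _
  (fun x => flatten (map (fun a => if f x a then [:: a] else [::]) (l x)))).
  apply: polytime_flatten.
  apply: (@polytime_map _ _ _ _ _ _ (fun x a => if f x a then [:: a] else [::])) => //.
  apply: polytime_if => //; last exact: polytime_const.
  by apply: polytime_cons; polytime_proj.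
by move=> x; elim: (l x) => //= a s ->; case: (f x a).
Qed.

Lemma polytime_leq_size A B {EA : Enc A} {EB : Enc B} c (l : A -> seq B) :
  polytime l -> polytime (fun x => c <= size (l x)).
Proof.
elim: c l => [|c IH] l hl; first exact: polytime_const.
apply: (@eq_polytime _ _ _ _ (fun x => ~~ nilp (l x) && (c <= size (behead (l x))))).
  apply: polytime_andb; first by apply: polytime_negb; exact: polytime_nilp.
  by apply: IH; exact: polytime_behead.
by move=> x; case: (l x).
Qed.

Lemma polytime_head A B {EA : Enc A} {EB : Enc B} d (l : A -> seq B) :
  polytime l -> polytime (fun x => head d (l x)).
Proof.
move=> hl; have [g pbg hg] := polytime_esize hl.
have hlast (s : seq B) x : foldl (fun _ a => a) x s = last x s.
  by elim: s x => //= a s IH x.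
apply: (@eq_polytime _ _ _ _ (fun x => foldl (fun _ a => a) d (rev (l x)))); last first.
  by move=> x; rewrite hlast; case: (l x) => // a s; rewrite rev_cons last_rcons.
apply: (@polytime_foldl _ _ _ _ _ _ (fun _ a _ => a) (fun x => rev (l x)) (fun=> d)
  (fun n => g n + esize d)).
- by polytime_proj.
- exact: polytime_rev.
- exact: polytime_const.
- by pbt.
- move=> x s1 s2 hx; rewrite hlast; have := hg x; rewrite -esize_rev hx esize_cat.
  have h0 : 0 < esize s2 by exact: esize_gt0.
  have : esize (last d s1) <= esize s1 + esize d; last by lia.
  by elim: s1 d {hx hg h0} => [|a s IH] x' //=; have := IH a; rewrite ?esize_cons; lia.
Qed.

(** * Unary arithmetic and equality tests *)

#[global] Instance Enc_unit : Enc unit := fun=> Leaf.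

(** Both sides are literally the same tree, so arithmetic on unary numbers becomes list
    processing. *)
Lemma enc_nseq n : enc (nseq n tt) = enc n.
Proof. by elim: n => //= n; rewrite /enc /= => ->. Qed.

Lemma polytime_nseq A {EA : Enc A} (f : A -> nat) :
  polytime f -> polytime (fun x => nseq (f x) tt).
Proof. by apply: polytime_recode (fun a => a) _ _ => // a; exact: enc_nseq. Qed.

Lemma polytime_size_unit A {EA : Enc A} (f : A -> seq unit) :
  polytime f -> polytime (fun x => size (f x)).
Proof.
apply: polytime_recode (fun a => a) _ _ => // a.
by rewrite -enc_nseq; congr enc; elim: (f a) => //= [[] s ->].
Qed.

Lemma polytime_succ A {EA : Enc A} (f : A -> nat) :
  polytime f -> polytime (fun x => (f x).+1).
Proof.
move=> hf; apply: (@eq_polytime _ _ _ _ (fun x => size (tt :: nseq (f x) tt))).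
  apply/polytime_size_unit/polytime_cons; first exact: polytime_const.
  exact: polytime_nseq.
by move=> x; rewrite /= size_nseq.
Qed.

Lemma polytime_leq A {EA : Enc A} (f g : A -> nat) :
  polytime f -> polytime g -> polytime (fun x => f x <= g x).
Proof.
move=> hf hg; apply: (@eq_polytime _ _ _ _
  (fun x => nilp (foldl (fun b _ => behead b) (nseq (f x) tt) (nseq (g x) tt)))); last first.
  move=> x; move: (f x) (g x) => m n; rewrite /leq.
  have -> : foldl (fun b _ => behead b) (nseq m tt) (nseq n tt) = nseq (m - n) tt.
    elim: n m => [|n IH] m; first by rewrite subn0.
    by case: m => [|m]; [rewrite /= (IH 0)|rewrite /= IH].
  by rewrite /nilp size_nseq.
have [h pbh hh] := polytime_esize (polytime_nseq hf).
apply: polytime_nilp; apply: (@polytime_foldl _ _ _ _ _ _ (fun _ _ b => behead b)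
  (fun x => nseq (g x) tt) (fun x => nseq (f x) tt) h) => //.
- by apply: polytime_behead; polytime_proj.
- exact: polytime_nseq.
- exact: polytime_nseq.
- move=> x s1 s2 _; apply: leq_trans (hh x); move: (nseq _ _).
  elim: s1 => //= _ s1 IH s; apply: leq_trans (IH _) _.
  by case: s => // a s; rewrite esize_cons /=; lia.
Qed.

(** Adding one to each entry of [iota 0 k] and prepending 0 gives [iota 0 k.+1], so successors are
    the only arithmetic involved. *)
Lemma polytime_iota A {EA : Enc A} (f : A -> nat) :
  polytime f -> polytime (fun x => iota 0 (f x)).
Proof.
move=> hf.
have hit (s : seq unit) : foldl (fun b _ => 0 :: map S b) [::] s = iota 0 (size s).
  have H m : forall k, foldl (fun b _ => 0 :: map S b) (iota 0 k) (nseq m tt) = iota 0 (k + m).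
    elim: m => [|m IH] k /=; first by rewrite addn0.
    have -> : 0 :: map S (iota 0 k) = iota 0 k.+1 by rewrite /= -[in RHS](addn0 1) iotaDl.
    by rewrite IH addSnnS.
  have -> : s = nseq (size s) tt by elim: s => //= [[] s <-].
  by rewrite (H _ 0) size_nseq.
apply: (@eq_polytime _ _ _ _
  (fun x => foldl (fun b _ => 0 :: map S b) [::] (nseq (f x) tt))); last first.
  by move=> x; rewrite hit size_nseq.
have [h pbh hh] := polytime_esize hf.
apply: (@polytime_foldl _ _ _ _ _ _ (fun _ _ b => 0 :: map S b)
  (fun x => nseq (f x) tt) (fun=> [::]) (fun n => h n * (h n + 1) + 1)) => //.
- apply: polytime_cons; first exact: polytime_const.
  by apply: (@polytime_map _ _ _ _ _ _ (fun _ n => n.+1)); [apply: polytime_succ|]; polytime_proj.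
- exact: polytime_nseq.
- exact: polytime_const.
- by pbt.
- move=> x s1 s2 hx; rewrite hit.
  have h1 : size s1 <= f x.
    by have := congr1 size hx; rewrite size_nseq size_cat => ->; rewrite leq_addr.
  have h2 := hh x; rewrite esize_nat in h2.
  have h3 : all (fun n => esize n <= h (esize x)) (iota 0 (size s1)).
    by apply/allP => n; rewrite mem_iota esize_nat; lia.
  apply: leq_trans (esize_le h3) _; rewrite size_iota; nia.
Qed.

Definition polytime_eqtype (A : eqType) {EA : Enc A} :=
  polytime (fun x : A * A => x.1 == x.2).
Arguments polytime_eqtype A {EA}.

Lemma polytime_eq G (A : eqType) {EG : Enc G} {EA : Enc A} (f g : G -> A) :
  polytime_eqtype A -> polytime f -> polytime g -> polytime (fun x => f x == g x).
Proof. by move=> hA hf hg; exact: polytime_comp (polytime_pair hf hg) hA. Qed.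

Lemma polytime_eq_nat : polytime_eqtype nat.
Proof.
apply: (@eq_polytime _ _ _ _ (fun x => (x.1 <= x.2) && (x.2 <= x.1))).
  by apply: polytime_andb; apply: polytime_leq; polytime_proj.
by move=> x; rewrite eqn_leq.
Qed.

Lemma polytime_eq_bool : polytime_eqtype bool.
Proof.
apply: (@eq_polytime _ _ _ _ (fun x => if x.1 then x.2 else ~~ x.2)).
  by apply: polytime_if; [|apply: id|apply: polytime_negb]; polytime_proj.
by case=> [[] []].
Qed.

Lemma polytime_eq_pair (A B : eqType) {EA : Enc A} {EB : Enc B} :
  polytime_eqtype A -> polytime_eqtype B -> polytime_eqtype (A * B)%type.
Proof.
move=> hA hB; apply: (@eq_polytime _ _ _ _ (fun x => (x.1.1 == x.2.1) && (x.1.2 == x.2.2))).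
  by apply: polytime_andb; apply: polytime_eq => //; polytime_proj.
by case=> [[a b] [c d]].
Qed.

Lemma polytime_mem G (A : eqType) {EG : Enc G} {EA : Enc A} (f : G -> A) (l : G -> seq A) :
  polytime_eqtype A -> polytime f -> polytime l -> polytime (fun x => f x \in l x).
Proof.
move=> hA hf hl; apply: (@eq_polytime _ _ _ _ (fun x => has (fun a => f x == a) (l x))).
  apply: (@polytime_has _ _ _ _ (fun x a => f x == a)) => //.
  apply: polytime_eq => //; last by polytime_proj.
  by refine (polytime_comp (f := fst) _ hf); polytime_proj.
by move=> x; rewrite -has_pred1; apply: eq_has => a /=; rewrite eq_sym.
Qed.

(** Recursion on the syntax of the function. The pattern of the constant case matches every
    abstraction, so it comes after all the specific ones. *)
Ltac polytime_step :=
  lazymatch goal with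
  | |- polytime_eqtype _ =>
    first [exact: polytime_eq_bool | exact: polytime_eq_nat | apply: polytime_eq_pair]
  | |- polytime (fun x => x) => exact: polytime_id
  | |- polytime (fun x => pair (@?f x) (@?g x)) =>
    refine (polytime_pair (f := f) (g := g) _ _); cbv beta
  | |- polytime (fun x => fst (@?f x)) => refine (polytime_fst (f := f) _); cbv beta
  | |- polytime (fun x => snd (@?f x)) => refine (polytime_snd (f := f) _); cbv beta
  | |- polytime (fun x => cons (@?f x) (@?g x)) =>
    refine (polytime_cons (f := f) (g := g) _ _); cbv beta
  | |- polytime (fun x => cat (@?f x) (@?g x)) =>
    refine (polytime_cat (l := f) (r := g) _ _); cbv beta
  | |- polytime (fun x => map (@?f x) (@?g x)) =>
    refine (polytime_map (f := f) (l := g) _ _); cbv beta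
  | |- polytime (fun x => filter (@?f x) (@?g x)) =>
    refine (polytime_filter (f := f) (l := g) _ _); cbv beta
  | |- polytime (fun x => has (@?f x) (@?g x)) =>
    refine (polytime_has (f := f) (l := g) _ _); cbv beta
  | |- polytime (fun x => all (@?f x) (@?g x)) =>
    refine (polytime_all (f := f) (l := g) _ _); cbv beta
  | |- polytime (fun x => flatten (@?f x)) => refine (polytime_flatten (l := f) _); cbv beta
  | |- polytime (fun x => behead (@?f x)) => refine (polytime_behead (f := f) _); cbv beta
  | |- polytime (fun x => nilp (@?f x)) => refine (polytime_nilp (f := f) _); cbv beta
  | |- polytime (fun x => head ?d (@?f x)) => refine (polytime_head d (l := f) _); cbv beta
  | |- polytime (fun x => iota 0 (@?f x)) => refine (polytime_iota (f := f) _); cbv beta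
  | |- polytime (fun x => S (@?f x)) => refine (polytime_succ (f := f) _); cbv beta
  | |- polytime (fun x => negb (@?f x)) => refine (polytime_negb (f := f) _); cbv beta
  | |- polytime (fun x => andb (@?f x) (@?g x)) =>
    refine (polytime_andb (f := f) (g := g) _ _); cbv beta
  | |- polytime (fun x => orb (@?f x) (@?g x)) =>
    refine (polytime_orb (f := f) (g := g) _ _); cbv beta
  | |- polytime (fun x => leq ?c (size (@?f x))) =>
    refine (polytime_leq_size c (l := f) _); cbv beta
  | |- polytime (fun x => eq_op (@?f x) (@?g x)) =>
    refine (polytime_eq (f := f) (g := g) _ _ _); cbv beta
  | |- polytime (fun x => in_mem (@?f x) (mem (@?g x))) =>
    refine (polytime_mem (f := f) (l := g) _ _ _); cbv beta
  | |- polytime (fun x => if _ then _ else _) => apply: polytime_if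
  | |- polytime (fun x => @?b x) => exact: polytime_const
  | |- @polytime ?A ?B ?EA ?EB ?f => change (@polytime A B EA EB (fun x => f x))
  end.

(** * Sparsification *)

Section Sparsification.

Variables (V : eqType) (th th3 : nat).
Implicit Types (L U S : seq V) (T Q : seq (V * V)) (C : seq (V * V * V)).

(* A state [(U, T)] adds unit clauses and 2-clauses to a fixed family [C] of
   3-clauses. [T] and [C] consist of ordered tuples and are closed under
   permutations, so that degrees are plain counts over the list [L] of literals;
   a tuple may repeat a literal. *)
Definition state : Type := seq V * seq (V * V).

Definition pairs L := [seq (a, b) | a <- L, b <- L].

Definition active2 U T (p : V * V) := [&& p \in T, p.1 \notin U & p.2 \notin U].

(** A 3-clause containing a unit or a 2-clause of the state is implied by it and no longer counts.
    Three of the six ordered pairs are tested, as [T] will be symmetric. *)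
Definition active3 C U T (t : V * V * V) :=
  [&& t \in C, t.1.1 \notin U, t.1.2 \notin U, t.2 \notin U, (t.1.1, t.1.2) \notin T,
      (t.1.1, t.2) \notin T & (t.1.2, t.2) \notin T].

Definition grow1 L U S := [seq a <- L | (a \in U) || (a \in S)].
Definition grow2 L T Q := [seq p <- pairs L | (p \in T) || (p \in Q)].

Definition petals_a L U T a := [seq b <- L | active2 U T (a, b)].
Definition petals_b L C U T p := [seq c <- L | active3 C U T (p, c)].
Definition petals_c L C U T a := [seq p <- pairs L | active3 C U T (a, p.1, p.2)].

(* Looks for a heart (a literal, a pair, a literal) that many active clauses
   share. A model either hits the heart or hits the rest (the petal) of each of
   these clauses. The order of the three searches matters: each one relies on the
   degree bounds left by the previous ones. *)
Definition step L C (X : state) : seq state :=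
  head [::]
    ([seq [:: (grow1 L X.1 [:: a], X.2); (grow1 L X.1 (petals_a L X.1 X.2 a), X.2)]
       | a <- L & th <= size (petals_a L X.1 X.2 a)] ++
     [seq [:: (X.1, grow2 L X.2 [:: p; (p.2, p.1)]); (grow1 L X.1 (petals_b L C X.1 X.2 p), X.2)]
       | p <- pairs L & th <= size (petals_b L C X.1 X.2 p)] ++
     [seq [:: (grow1 L X.1 [:: a], X.2); (X.1, grow2 L X.2 (petals_c L C X.1 X.2 a))]
       | a <- L & th3 <= size (petals_c L C X.1 X.2 a)]).

Definition sat (h : pred V) C (X : state) :=
  [&& all h X.1, all (fun p => h p.1 || h p.2) X.2 &
      all (fun t => [|| h t.1.1, h t.1.2 | h t.2]) C].

Definition deg2 L U T a := \sum_(b <- L) active2 U T (a, b).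
Definition num2 L U T := \sum_(a <- L) deg2 L U T a.
Definition num1 L U := \sum_(a <- L) (a \notin U).
(* A bound on the number of pairs that can still be added: an active literal
   occurs in at most [2 * th] active pairs, in either position. *)
Definition pot L (X : state) := 4 * th * num1 L X.1 - num2 L X.1 X.2.

(** The degree bound is an invariant: pairs are added only when every degree is below [th], and an
    addition raises a degree by at most 2 (pair heart) or by less than [th] (petal of a literal in
    3-clauses). *)
Record good L (X : state) : Prop := Good {
  good1 : subseq X.1 L;
  good2 : subseq X.2 (pairs L);
  good_sym : forall a b, (a, b) \in X.2 -> (b, a) \in X.2;
  good_deg : forall a, a \in L -> deg2 L X.1 X.2 a <= 2 * th }.

Lemma countE (A : Type) (p : pred A) (s : seq A) : count p s = \sum_(a <- s) p a.
Proof. by elim: s => [|a s IH]; rewrite ?big_nil // big_cons /= IH. Qed.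

Lemma size_petals_a L U T a : size (petals_a L U T a) = deg2 L U T a.
Proof. by rewrite size_filter countE. Qed.

Lemma count_pairs L (p : pred (V * V)) :
  count p (pairs L) = \sum_(a <- L) \sum_(b <- L) p (a, b).
Proof. by rewrite countE big_allpairs. Qed.

Lemma mem_pairs L a b : ((a, b) \in pairs L) = (a \in L) && (b \in L).
Proof.
apply/allpairsP/andP => [[p [h1 h2 [-> ->]]]|[ha hb]]; first by split.
by exists (a, b).
Qed.

Lemma uniq_pairs L : uniq L -> uniq (pairs L).
Proof. by move=> uL; apply: allpairs_uniq => // -[a b] [c d] _ _ /= [-> ->]. Qed.

Lemma active2_sym U T a b : (forall a b, (a, b) \in T -> (b, a) \in T) ->
  active2 U T (a, b) = active2 U T (b, a).
Proof.
move=> hT; rewrite /active2 /= [X in _ = _ && X]andbC; congr (_ && _).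
by apply/idP/idP; apply: hT.
Qed.

Lemma leq_sum_seq (A : eqType) (s : seq A) (F G : A -> nat) :
  (forall a, a \in s -> F a <= G a) -> \sum_(a <- s) F a <= \sum_(a <- s) G a.
Proof.
move=> h; rewrite big_seq [X in _ <= X]big_seq; apply: leq_sum => a; exact: h.
Qed.

Lemma leq_deg2 L U U' T a : {subset U <= U'} -> deg2 L U' T a <= deg2 L U T a.
Proof.
move=> hU; apply: leq_sum => b _; rewrite /active2 /=.
case: (_ \in T) => //=; case: (boolP (a \in U)) => [/hU -> //|_].
by case: (boolP (b \in U)) => [/hU ->|_]; [rewrite andbF|rewrite leq_b1].
Qed.

(** Keeps the truncated subtraction in [pot] exact. *)
Lemma num2_le L X : good L X -> num2 L X.1 X.2 <= 2 * th * num1 L X.1.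
Proof.
move=> gX; rewrite /num1 big_distrr /=; apply: leq_sum_seq => a aL.
case: (boolP (a \in X.1)) => haU; last by rewrite muln1 (good_deg gX).
rewrite muln0 leqn0 /deg2 big1 // => b _; by rewrite /active2 /= haU andbF.
Qed.

Lemma sum_mem_le L S (F : V -> nat) m : uniq L -> uniq S ->
  {in L, forall a, F a <= m} -> \sum_(a <- L) (a \in S) * F a <= m * size S.
Proof.
move=> uL uS hF.
apply: leq_trans (_ : \sum_(a <- L) m * (a \in S) <= _).
  by apply: leq_sum_seq => a aL; case: (a \in S); rewrite ?mul0n // mul1n muln1 hF.
rewrite -big_distrr /= leq_mul2l -(countE (mem S)) -size_filter; apply/orP; right.
apply: uniq_leq_size; first exact: filter_uniq.
by move=> a; rewrite mem_filter => /andP[].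
Qed.

Lemma mem_grow1 L U S a : {subset U <= L} -> {subset S <= L} ->
  (a \in grow1 L U S) = (a \in U) || (a \in S).
Proof.
move=> hU hS; rewrite mem_filter.
by apply/idP/idP => [/andP[]//|h]; rewrite h /=; case/orP: h => [/hU|/hS].
Qed.

Lemma mem_grow2 L T Q p : {subset T <= pairs L} -> {subset Q <= pairs L} ->
  (p \in grow2 L T Q) = (p \in T) || (p \in Q).
Proof.
move=> hU hS; rewrite mem_filter.
by apply/idP/idP => [/andP[]//|h]; rewrite h /=; case/orP: h => [/hU|/hS].
Qed.

Lemma good_grow1 L X S : uniq L -> good L X -> {subset S <= L} ->
  good L (grow1 L X.1 S, X.2).
Proof.
move=> uL gX hS; split=> /=.
- exact: filter_subseq.
- exact: good2 gX.
- exact: good_sym gX.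
- move=> a aL; apply: leq_trans (good_deg gX aL); apply: leq_deg2 => b hb.
  by rewrite mem_grow1 ?hb //; exact: mem_subseq (good1 gX).
Qed.

(* Each new unit literal deactivates at most [4 * th] ordered pairs. *)
Lemma pot_grow1 L X S : uniq L -> good L X -> {subset S <= L} -> uniq S ->
  all (fun a => a \notin X.1) S ->
  num1 L (grow1 L X.1 S) + size S = num1 L X.1 /\
  pot L (grow1 L X.1 S, X.2) <= pot L X.
Proof.
move=> uL gX hS uS /allP hSU; have hU := mem_subseq (good1 gX).
have e1 : num1 L (grow1 L X.1 S) + size S = num1 L X.1.
  have -> : size S = \sum_(a <- L) (a \in S).
    rewrite -(countE (mem S)) -size_filter; apply/perm_size/uniq_perm => //.
      exact: filter_uniq.
    by move=> a; rewrite mem_filter /=; case: (boolP (a \in S)) => // /hS ->.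
  rewrite /num1 -big_split /=; apply: eq_big_seq => a aL.
  rewrite mem_grow1 //; case: (boolP (a \in S)) => [/hSU /negPf ->|_]; first by [].
  by rewrite orbF addn0.
split=> //.
suff : num2 L X.1 X.2 <= num2 L (grow1 L X.1 S) X.2 + 4 * th * size S.
  by rewrite /pot /= -e1; lia.
(* The lost pairs have a component in [S]. Those with the first component there and those with the
   second there are counted separately, at most [2 * th] for each element of [S]. *)
have h1 : \sum_(a <- L) \sum_(b <- L) (a \in S) * active2 X.1 X.2 (a, b) <= 2 * th * size S.
  apply: leq_trans (sum_mem_le uL uS (good_deg gX)).
  by apply: leq_sum => a _; rewrite /deg2 big_distrr.
have h2 : \sum_(a <- L) \sum_(b <- L) (b \in S) * active2 X.1 X.2 (a, b) <= 2 * th * size S.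
  rewrite exchange_big /=; apply: leq_trans h1; apply: leq_sum => a _; apply: leq_sum => b _.
  by rewrite active2_sym //; exact: good_sym gX.
have : num2 L X.1 X.2 <= num2 L (grow1 L X.1 S) X.2 +
   (\sum_(a <- L) \sum_(b <- L) (a \in S) * active2 X.1 X.2 (a, b) +
    \sum_(a <- L) \sum_(b <- L) (b \in S) * active2 X.1 X.2 (a, b)); last by lia.
rewrite /num2 /deg2 -!big_split /=; apply: leq_sum => a _.
rewrite -!big_split /=; apply: leq_sum => b _.
rewrite /active2 /= !mem_grow1 // !negb_or.
by case: (_ \in X.2); case: (a \in X.1); case: (b \in X.1); case: (a \in S); case: (b \in S).
Qed.

Lemma deg2_grow2 L X Q a : good L X -> {subset Q <= pairs L} ->
  deg2 L X.1 (grow2 L X.2 Q) a <= deg2 L X.1 X.2 a + \sum_(b <- L) ((a, b) \in Q).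
Proof.
move=> gX hQ; have hT := mem_subseq (good2 gX); rewrite /deg2 -big_split /=; apply: leq_sum => b _.
rewrite /active2 mem_grow2 //=.
by case: (_ \in X.2); case: (_ \in Q); case: (a \in X.1); case: (b \in X.1).
Qed.

(** The new pairs are active, so they all enter [num2] while [num1] stays. The degree bound of the
    new state keeps [num2] below the minuend of [pot], so the potential drops by their full
    number. *)
Lemma pot_grow2 L X Q q : uniq L -> good L X -> {subset Q <= pairs L} ->
  (forall p, p \in Q -> [/\ p \notin X.2, p.1 \notin X.1 & p.2 \notin X.1]) ->
  good L (X.1, grow2 L X.2 Q) ->
  q <= count (mem Q) (pairs L) -> pot L (X.1, grow2 L X.2 Q) + q <= pot L X.
Proof.
move=> uL gX hQ hnew gX' hq.
have h1 := num2_le gX'; rewrite /= in h1.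
have : num2 L X.1 X.2 + q <= num2 L X.1 (grow2 L X.2 Q); last by rewrite /pot /=; lia.
apply: leq_trans (_ : num2 L X.1 X.2 + count (mem Q) (pairs L) <= _); first by lia.
rewrite count_pairs /num2 /deg2 -big_split /=; apply: leq_sum => a _.
rewrite -big_split /=; apply: leq_sum => b _.
rewrite /active2 mem_grow2 //=; last exact: mem_subseq (good2 gX).
case: (boolP (_ \in Q)) => [/hnew /= [/negPf -> -> ->] //|_].
by rewrite orbF addn0.
Qed.

Definition sparse L C (X : state) :=
  count (active2 X.1 X.2) (pairs L) <= size L * th /\
  count (fun x => active3 C X.1 X.2 (x.1, x.2.1, x.2.2)) [seq (a, p) | a <- L, p <- pairs L]
    <= size L * th3.

(** The three alternatives are the three searches: a literal in 2-clauses, a pair in 3-clauses, a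
    literal in 3-clauses. In each, the heart branch lowers one of the two measures by 1 and the
    petal branch lowers one by a threshold. *)
Variant step_spec L C (X : state) : seq state -> Prop :=
  | StepStop of sparse L C X : step_spec L C X [::]
  | StepBranch X1 X2 of good L X1 & good L X2 &
      (forall h, sat h C X = sat h C X1 || sat h C X2) &
      num1 L X1.1 <= num1 L X.1 & num1 L X2.1 <= num1 L X.1 &
      pot L X1 <= pot L X & pot L X2 <= pot L X &
      [\/ num1 L X1.1 + 1 <= num1 L X.1 /\ num1 L X2.1 + th <= num1 L X.1,
          pot L X1 + 1 <= pot L X /\ num1 L X2.1 + th <= num1 L X.1 |
          num1 L X1.1 + 1 <= num1 L X.1 /\ pot L X2 + th3 <= pot L X] :
      step_spec L C X [:: X1; X2].

Lemma head_map_filter (A : eqType) (B : Type) (f : A -> B) (P : pred A) d s r :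
  (exists a, [/\ a \in s, P a & head d ([seq f a | a <- s & P a] ++ r) = f a]) \/
  ({in s, forall a, ~~ P a} /\ head d ([seq f a | a <- s & P a] ++ r) = head d r).
Proof.
case E: [seq a <- s | P a] => [|a l].
  right; split=> // a aS; apply/negP => Pa.
  by have := mem_filter P a s; rewrite E aS Pa.
left; exists a; have : a \in [seq a <- s | P a] by rewrite E mem_head.
by rewrite mem_filter => /andP[].
Qed.

Lemma sum_eq_le1 (L : seq V) c : uniq L -> \sum_(b <- L) (b == c) <= 1.
Proof. by move=> uL; rewrite -(countE (pred1 c)) count_uniq_mem // leq_b1. Qed.

Lemma stepP L C X : uniq L -> 0 < th -> 0 < th3 ->
  (forall t, t \in C -> [/\ t.1.1 \in L, t.1.2 \in L & t.2 \in L]) ->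
  (forall a b c, (a, b, c) \in C -> (b, a, c) \in C /\ (a, c, b) \in C) ->
  good L X -> step_spec L C X (step L C X).
Proof.
move=> uL th0 th30 CL Csym gX; have hT := mem_subseq (good2 gX); have hU := mem_subseq (good1 gX).
have satU h R S' : {subset S' <= L} -> sat h C (grow1 L X.1 S', R) =
    [&& all h X.1, all h S', all (fun p => h p.1 || h p.2) R &
        all (fun t => [|| h t.1.1, h t.1.2 | h t.2]) C].
  move=> hS'; rewrite /sat /= [RHS]andbA; congr (_ && _); rewrite -all_cat.
  by apply: eq_all_r => a; rewrite mem_grow1 // mem_cat.
have satT h Q : {subset Q <= pairs L} -> sat h C (X.1, grow2 L X.2 Q) =
    [&& all h X.1, all (fun p => h p.1 || h p.2) X.2, all (fun p => h p.1 || h p.2) Q &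
        all (fun t => [|| h t.1.1, h t.1.2 | h t.2]) C].
  move=> hQ; rewrite /sat /=; congr (_ && _); rewrite [RHS]andbA; congr (_ && _).
  by rewrite -all_cat; apply: eq_all_r => a; rewrite mem_grow2 // mem_cat.
have sub1 a : a \in L -> {subset [:: a] <= L} by move=> aL b; rewrite inE => /eqP ->.
rewrite /step; set ra := (X in _ ++ (X ++ _)); set rb := (X in _ ++ (_ ++ X)).
set fa := (fun a : V => [:: (grow1 L X.1 [:: a], X.2); (grow1 L X.1 (petals_a L X.1 X.2 a), X.2)]).
have [[a [aL ha ->]]|[na ->]] := head_map_filter fa
    (fun a => th <= size (petals_a L X.1 X.2 a)) [::] L (ra ++ rb).
  have hS : {subset petals_a L X.1 X.2 a <= L} by move=> b; rewrite mem_filter => /andP[].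
  (* The petal is non-empty since [th] is positive, and any active pair in it shows that [a] is not
     yet forced. This is what makes the heart branch progress. *)
  have aU : a \notin X.1.
    have : petals_a L X.1 X.2 a <> [::] by move=> h; move: ha th0; rewrite h /=; lia.
    by case E: petals_a => [|b l] // _; have := mem_head b l; rewrite -E mem_filter => /andP[/and3P[]].
  have [|n1 p1] := pot_grow1 uL gX (sub1 _ aL) (isT : uniq [:: a]).
    by rewrite /= aU.
  have [|n2 p2] := pot_grow1 uL gX hS (filter_uniq _ uL).
    by apply/allP => b; rewrite mem_filter => /andP[/and3P[]].
  rewrite /= in n1 n2; apply: StepBranch.
  - exact: good_grow1 (sub1 _ aL).
  - exact: good_grow1.
  - move=> h; rewrite !satU //; last exact: sub1.
    rewrite /sat; case: (all h X.1) => //=; rewrite andbT.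
    case hX2: (all _ X.2); rewrite ?andbF //=; case: (all _ C); rewrite ?andbF ?andbT //.
    rewrite orbC; case hha: (h a); rewrite ?orbT // orbF; symmetry; apply/allP => b.
    rewrite mem_filter => /andP[/and3P[/= hab _ _] _].
    by move/allP: hX2 => /(_ _ hab) /=; rewrite hha.
  - by rewrite /= -n1 leq_addr.
  - by rewrite /= -n2 leq_addr.
  - exact: p1.
  - exact: p2.
  - by apply: Or31; split; rewrite /= ?n1 // -n2 leq_add2l.
have {}na a : a \in L -> deg2 L X.1 X.2 a < th.
  by move=> /na; rewrite size_petals_a -ltnNge.
set fb := (fun p : V * V => [:: (X.1, grow2 L X.2 [:: p; (p.2, p.1)]);
  (grow1 L X.1 (petals_b L C X.1 X.2 p), X.2)]).
have [[[a b] [abL hab ->]]|[nb ->]] := head_map_filter fb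
    (fun p => th <= size (petals_b L C X.1 X.2 p)) [::] (pairs L) rb.
  have hS : {subset petals_b L C X.1 X.2 (a, b) <= L} by move=> c; rewrite mem_filter => /andP[].
  have [aL bL] : a \in L /\ b \in L by apply/andP; rewrite -mem_pairs.
  have [aU bU abT] : [/\ a \notin X.1, b \notin X.1 & (a, b) \notin X.2].
    have : petals_b L C X.1 X.2 (a, b) <> [::] by move=> h; move: hab th0; rewrite h /=; lia.
    case E: petals_b => [|c l] // _; have := mem_head c l; rewrite -E mem_filter.
    by case/andP => /and5P[/= _ -> -> _ /and3P[]].
  have baT : (b, a) \notin X.2 by apply: contra abT => /(good_sym gX).
  have hQ : {subset [:: (a, b); (b, a)] <= pairs L}.
    by move=> p; rewrite !inE => /orP[] /eqP ->; rewrite mem_pairs aL bL.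
  have gX1 : good L (X.1, grow2 L X.2 [:: (a, b); (b, a)]).
    split=> /=; [exact: good1 gX|exact: filter_subseq| |].
    - move=> x y; rewrite !mem_grow2 // !inE !xpair_eqE => /or3P[/(good_sym gX) ->//||].
      + by case/andP => -> ->; rewrite !orbT.
      + by case/andP => -> ->; rewrite !orbT.
    (* The degree of [x] was at most [th - 1] and grows by at most 2, through [a] and [b]; [th + 1]
       is within [2 * th] because [th] is positive. *)
    - move=> x xL; apply: leq_trans (deg2_grow2 x gX hQ) _.
      have h1 := na _ xL.
      suff h2 : \sum_(y <- L) ((x, y) \in [:: (a, b); (b, a)]) <= 2.
        by apply: leq_trans (leq_add (leqnn _) h2) _; clear -h1 th0; lia.
      apply: leq_trans (_ : \sum_(y <- L) ((y == b) + (y == a)) <= _).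
        apply: leq_sum => y _; rewrite !inE !xpair_eqE.
        by case: (x == a); case: (x == b); case: (y == a); case: (y == b).
      by rewrite big_split /= -[2]/(1 + 1) leq_add // sum_eq_le1.
  have [|n2 p2] := pot_grow1 uL gX hS (filter_uniq _ uL).
    by apply/allP => c; rewrite mem_filter => /andP[/and5P[_ _ _ -> _]].
  (* Only one new ordered pair is guaranteed, since [a] and [b] may coincide. *)
  have p1 : pot L (X.1, grow2 L X.2 [:: (a, b); (b, a)]) + 1 <= pot L X.
    apply: pot_grow2 => //.
    - by move=> p; rewrite !inE => /orP[] /eqP ->.
    - by rewrite -has_count; apply/hasP; exists (a, b) => //; rewrite inE /= mem_head.
  rewrite /= in n2; apply: StepBranch => //.
  - exact: good_grow1.
  - move=> h; rewrite satT // satU // /sat /=; case: (all h X.1) => //=.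
    case hX2: (all _ X.2); rewrite ?andbF //=.
    case hC: (all _ C); rewrite ?andbF ?andbT //.
    rewrite [h b || h a]orbC andbb; case hh: (h a || h b) => //=.
    symmetry; apply/allP => c; rewrite mem_filter => /andP[/and5P[/= hc _ _ _ _] _].
    by move/allP: hC => /(_ _ hc) /=; rewrite orbA hh.
  - by rewrite /= -n2 leq_addr.
  - by apply: leq_trans p1; rewrite leq_addr.
  - by apply: Or32; split; rewrite /= -?n2 ?leq_add2l.
have {}nb a b : a \in L -> b \in L -> \sum_(c <- L) active3 C X.1 X.2 (a, b, c) < th.
  move=> aL bL; have /nb : (a, b) \in pairs L by rewrite mem_pairs aL.
  by rewrite size_filter countE -ltnNge.
set fc := (fun a : V => [:: (grow1 L X.1 [:: a], X.2); (X.1, grow2 L X.2 (petals_c L C X.1 X.2 a))]).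
rewrite /rb -[X in head _ X]cats0.
have [[a [aL ha ->]]|[nc ->]] := head_map_filter fc
    (fun a => th3 <= size (petals_c L C X.1 X.2 a)) [::] L [::].
  set Q := petals_c L C X.1 X.2 a in ha *.
  have hQ : {subset Q <= pairs L} by move=> b; rewrite mem_filter => /andP[].
  have inQ p : p \in Q -> [/\ (a, p.1, p.2) \in C, p \notin X.2, p.1 \notin X.1 & p.2 \notin X.1].
    by case: p => b c; rewrite mem_filter => /andP[/and5P[/= -> _ -> -> /and3P[_ _ ->]] _].
  have Qsym b c : (b, c) \in Q -> (c, b) \in Q.
    rewrite !mem_filter !mem_pairs /active3 /= => /andP[/and5P[hC -> -> -> /and3P[-> -> hbc]] /andP[-> ->]].
    rewrite !andbT; apply/andP; split; first by case: (Csym _ _ _ hC).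
    by apply: contra hbc => /(good_sym gX).
  have aU : a \notin X.1.
    have : Q <> [::] by move=> h; move: ha th30; rewrite h /=; lia.
    rewrite /Q; case E: petals_c => [|c l] // _; have := mem_head c l; rewrite -E mem_filter.
    by case/andP => /and5P[/= _ -> _ _ _].
  have [|n1 p1] := pot_grow1 uL gX (sub1 _ aL) (isT : uniq [:: a]).
    by rewrite /= aU.
  have gX2 : good L (X.1, grow2 L X.2 Q).
    split=> /=; [exact: good1 gX|exact: filter_subseq| |].
    - move=> x y; rewrite !mem_grow2 // => /orP[/(good_sym gX) ->//|/Qsym ->].
      by rewrite orbT.
    (* A new pair [(x, y)] comes from an active triple [(a, x, y)], and by the failure of the second
       search there are fewer than [th] of these for given [a] and [x]. *)
    - move=> x xL; apply: leq_trans (deg2_grow2 x gX hQ) _.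
      have h1 := na _ xL; have h2 := nb _ _ aL xL.
      suff h3 : \sum_(y <- L) ((x, y) \in Q) <= \sum_(c <- L) active3 C X.1 X.2 (a, x, c).
        by apply: leq_trans (leq_add (ltnW h1) (leq_trans h3 (ltnW h2))) _; rewrite addnn -mul2n.
      by apply: leq_sum => y _; rewrite mem_filter; case: active3 => //; exact: leq_b1.
  have p2 : pot L (X.1, grow2 L X.2 Q) + th3 <= pot L X.
    apply: pot_grow2 => //; first by move=> p /inQ[].
    apply: leq_trans ha _; rewrite -size_filter; apply: uniq_leq_size.
      exact/filter_uniq/uniq_pairs.
    by move=> p hp; rewrite mem_filter inE /= hp hQ.
  rewrite /= in n1; apply: StepBranch => //.
  - exact: good_grow1 (sub1 _ aL).
  - move=> h; rewrite satT // satU //; last exact: sub1.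
    rewrite /sat /=; case: (all h X.1) => //=; rewrite andbT.
    case hX2: (all _ X.2); rewrite ?andbF //=.
    case hC: (all _ C); rewrite ?andbF ?andbT //.
    case hh: (h a) => //=; symmetry; apply/allP => p /inQ[hp _ _ _].
    by move/allP: hC => /(_ _ hp) /=; rewrite hh.
  - by rewrite /= -n1 leq_addr.
  - by apply: leq_trans p2; rewrite leq_addr.
  - by apply: Or33; split; rewrite /= ?n1.
apply: StepStop; split.
- rewrite count_pairs; apply: leq_trans (_ : \sum_(a <- L) th <= _).
    by apply: leq_sum_seq => a /na /ltnW.
  by rewrite big_const_seq count_predT iter_addn_0 mulnC.
- rewrite countE big_allpairs; apply: leq_trans (_ : \sum_(a <- L) th3 <= _).
    apply: leq_sum_seq => a aL /=; have := nc a aL; rewrite -ltnNge size_filter countE.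
    exact: ltnW.
  by rewrite big_const_seq count_predT iter_addn_0 mulnC.
Qed.

End Sparsification.

(** * From hitting sets to offensive alliances *)

Definition lit : Type := bool * nat.

(* Locked, because simplification would unroll [lits n.+1]. *)
Definition lits n : seq lit :=
  locked (map (pair true) (iota 0 n) ++ map (pair false) (iota 0 n)).

Lemma mem_lits n (u : lit) : (u \in lits n) = (u.2 < n).
Proof.
case: u => b v; rewrite /lits -lock mem_cat; apply/orP/idP => /= [[] /mapP[x]|hv].
- by rewrite mem_iota => hx [_ ->].
- by rewrite mem_iota => hx [_ ->].
- by case: b; [left|right]; apply: map_f; rewrite mem_iota.
Qed.

Lemma uniq_lits n : uniq (lits n).
Proof.
rewrite /lits -lock cat_uniq !map_inj_uniq ?iota_uniq ?andbT //=; try by move=> x y [].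
by apply/hasP => -[_ /mapP[x _ ->] /mapP[]].
Qed.

Lemma size_lits n : size (lits n) = 2 * n.
Proof. by rewrite /lits -lock size_cat !size_map size_iota mul2n addnn. Qed.

(* Vertices are tagged by their side of the bipartition. The left vertices are
   two hubs, carrying [::], and the literals; a right vertex carries a clause
   and is adjacent to both hubs and to the literals of the clause. *)
Definition desc : Type := bool * seq lit.

(** List inclusion serves both kinds of left vertices: the empty list of a hub lies in every clause,
    the singleton of a literal only in the clauses containing that literal. *)
Definition adjd (x y : desc) : bool :=
  if x.1 then ~~ y.1 && all (fun u => u \in y.2) x.2
  else y.1 && all (fun u => u \in x.2) y.2.

Lemma adjd_sym : symmetric adjd.
Proof. by case=> [[] s] [[] t]. Qed.

Lemma adjd_irr : irreflexive adjd.
Proof. by case=> [[] s]. Qed.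

Definition hub : desc := (true, [::]).

Definition verts n (F : seq (seq lit)) : seq desc :=
  [:: hub, hub & [seq (true, [:: u]) | u <- lits n] ++ [seq (false, f) | f <- F]].

Lemma size_verts n F : size (verts n F) = 2 + 2 * n + size F.
Proof. by rewrite /verts /= size_cat !size_map size_lits; lia. Qed.

Definition graph_of (s : seq desc) : graph :=
  @Graph (size s) (fun i j => adjd (nth hub s i) (nth hub s j))
    (fun i j => adjd_sym _ _) (fun i => adjd_irr _).

Lemma bipartite_graph_of s : bipartite (graph_of s).
Proof.
exists [set i : vertex (graph_of s) | (nth hub s i).1] => u v; rewrite !inE /= /adjd.
by case: (nth hub s u).1; case: (nth hub s v).1.
Qed.

Lemma card_le_seq (T : finType) (X : eqType) (A : {set T}) (g : T -> X) (s : seq X) :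
  {in A &, injective g} -> (forall i, i \in A -> g i \in s) -> #|A| <= size s.
Proof.
move=> ginj gs; rewrite cardE -(size_map g); apply: uniq_leq_size.
  by rewrite map_inj_in_uniq ?enum_uniq // => i j; rewrite !mem_enum; exact: ginj.
by move=> x /mapP[i]; rewrite mem_enum => /gs hi ->.
Qed.

(** * Correctness of the alliance gadget *)

Section Alliance.

Variables (n : nat) (F : seq (seq lit)).

Hypothesis F_lits : forall f u, f \in F -> u \in f -> u \in lits n.
Hypothesis F_size : forall f, f \in F -> size f <= 3.
Hypothesis F_two : forall f, f \in F -> f <> [::] ->
  exists x y, [/\ x \in f, y \in f & x <> y].
Hypothesis F_nil : [::] \in F.
Hypothesis F_pair : forall v, v < n -> [:: (true, v); (false, v)] \in F.
Hypothesis F_large : 2 * (n + 2) < size F.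

Let G := graph_of (verts n F).
Let D (i : vertex G) : desc := nth hub (verts n F) i.

Let adjE (i j : vertex G) : adj i j = adjd (D i) (D j).
Proof. by []. Qed.

Let D_mem i : D i \in verts n F.
Proof. by rewrite mem_nth. Qed.

Let D_ex d : d \in verts n F -> exists i, D i = d.
Proof.
rewrite -index_mem => h; exists (Ordinal h : vertex G).
by rewrite /D /= nth_index // -index_mem.
Qed.

Let D_left (i : vertex G) : (D i).1 -> D i = hub \/ exists2 u, u \in lits n & D i = (true, [:: u]).
Proof.
move: (D_mem i); rewrite !inE mem_cat => /or3P[/eqP ->|/eqP ->|]; [by left|by left|].
case/orP => /mapP[u hu ->] //= _; by right; exists u.
Qed.

Let D_right (i : vertex G) : ~~ (D i).1 -> exists2 f, f \in F & D i = (false, f).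
Proof.
move: (D_mem i); rewrite !inE mem_cat => /or3P[/eqP ->|/eqP ->|] //.
case/orP => /mapP[u hu ->] //= _; by exists u.
Qed.

(** Hubs and clauses may repeat in [verts]. A literal vertex is determined by its literal, so sets
    of literal vertices can be counted through their literals. *)
Let D_lit (i j : vertex G) u : D i = (true, [:: u]) -> D j = (true, [:: u]) -> i = j.
Proof.
have H (k : vertex G) : D k = (true, [:: u]) -> k = 2 + index u (lits n) :> nat.
  case: k => -[|[|k]] //= hk; rewrite /D /= nth_cat size_map.
  case: ltnP => hk2; last first.
    by rewrite (nth_map [::]) //; move: hk hk2; rewrite /= size_cat !size_map; clear; lia.
  rewrite (nth_map (true, 0)) // => -[<-].
  by rewrite index_uniq // uniq_lits.
by move=> hi hj; apply: val_inj; rewrite /= (H _ hi) (H _ hj).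
Qed.

Let A0 : vertex G := ord0.
Let A1 : vertex G := lift ord0 ord0.

Let D_hub (i : vertex G) : (D i == hub) = (i \in [set A0; A1]).
Proof.
rewrite !inE; apply/eqP/orP => [|[/eqP ->|/eqP ->]] //.
case: i => -[|[|k]] //= hk; [by left|by right|].
rewrite /D /= nth_cat size_map; case: ltnP => hk2.
  by rewrite (nth_map (true, 0)).
by rewrite (nth_map [::]) //; move: hk hk2; rewrite /= size_cat !size_map; clear; lia.
Qed.

Let adj_right i j f : D i = (false, f) ->
  adj i j = (D j).1 && all (fun u => u \in f) (D j).2.
Proof. by rewrite adjE => ->. Qed.

Let card_right : #|[set j : vertex G | ~~ (D j).1]| = size F.
Proof.
rewrite cardsE cardE size_filter -(size_map (pair false) F).
have -> : [seq (false, f) | f <- F] = [seq d <- verts n F | ~~ d.1].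
  rewrite /= filter_cat (_ : [seq d <- map _ _ | _] = [::]) ?cat0s; last first.
    by elim: (lits n).
  by elim: F => //= f F' <-.
rewrite size_filter.
rewrite -[in RHS](mkseq_nth hub (verts n F)) /mkseq -val_enum_ord -map_comp count_map.
by rewrite enumT; apply: eq_count.
Qed.

Let hub_in (S : {set vertex G}) i f : D i = (false, f) -> [set j in S | adj i j] =
  (S :&: [set A0; A1]) :|: [set j in S | (D j).1 && (D j != hub) && all (fun u => u \in f) (D j).2].
Proof.
move=> hi; apply/setP => j; rewrite !inE (adj_right j hi).
have := D_hub j; rewrite !inE => <-.
case: (j \in S) => //=; case: eqP => [->|_] //=; by rewrite andbT.
Qed.

Section Forward.

Variable a : nat -> bool.
Hypothesis a_hits : forall f, f \in F -> f <> [::] -> has (fun u => a u.2 == u.1) f.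

Let S := [set i : vertex G | (D i).1 && all (fun u => a u.2 == u.1) (D i).2].

(** [S] consists of the hubs and the true literals, so only clause vertices neighbour it. A
    non-empty clause has at most two false literals outside, against two hubs and a true literal
    inside; an empty clause has only the two hubs as neighbours. *)
Lemma alliance_of_assignment : has_offensive_alliance (G, n + 2).
Proof.
have AS : [set A0; A1] \subset S.
  by apply/subsetP => i; rewrite -D_hub inE => /eqP ->.
have S_inj (B : {set vertex G}) (P : pred lit) :
    {in B, forall j, exists2 u, P u & D j = (true, [:: u])} ->
    {in B &, injective (fun j => head (true, 0) (D j).2)}.
  move=> hB i j /hB[u _ hu] /hB[w _ hw]; rewrite hu hw /= => e.
  by apply: (@D_lit _ _ u) => //; rewrite hw e.
exists S; split; last first.
  rewrite (leq_trans _ (subset_leq_card AS)) ?cards2 //=.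
  rewrite -(cardsID [set A0; A1] S) addnC leq_add //; last first.
    by apply: leq_trans (subset_leq_card (subsetIr _ _)) _; rewrite cards2.
  have hS : {in S :\: [set A0; A1], forall j,
      exists2 u, (u \in lits n) && (a u.2 == u.1) & D j = (true, [:: u])}.
    move=> j; rewrite in_setD -D_hub inE => /and3P[jh jl].
    case: (D_left jl) jh => [->|[u hu ->]] //= _; rewrite andbT => hau.
    by exists u => //; rewrite hu.
  rewrite -(size_iota 0 n); apply: (@card_le_seq _ _ _ (fun j => (head (true, 0) (D j).2).2)).
    move=> i j hi hj; have [u /andP[_ /eqP hu] Di] := hS _ hi.
    have [w /andP[_ /eqP hw] Dj] := hS _ hj; rewrite Di Dj /= => e.
    apply: (@D_lit _ _ u) => //; rewrite Dj; congr (_, [:: _]).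
    by case: (u) (w) hu hw e => [? ?] [? ?] /= <- <- ->.
  by move=> j /hS[u /andP[hu _] ->] /=; rewrite mem_iota -mem_lits.
split; first by apply/set0Pn; exists A0; rewrite (subsetP AS) // !inE eqxx.
move=> i; rewrite !inE => /andP[iS /exists_inP[j]].
rewrite inE adjE => /andP[jl _] ij.
have [|f fF Di] := @D_right i; first by move: ij; rewrite /adjd jl => /andP[].
rewrite /deg_in (hub_in S Di) (hub_in (~: S) Di) (_ : ~: S :&: _ = finset.set0) ?set0U; last first.
  apply/setP => k; rewrite in_set0 in_setI in_setC; apply/negP => /andP[/negP h1 h2].
  by case: h1; apply: (subsetP AS).
have -> : S :&: [set A0; A1] = [set A0; A1] by apply/setIidPr.
rewrite addn1; set B := (X in #|pred_of_set X| < _).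
have hB : {in B, forall k, exists2 u, (u \in f) && (a u.2 != u.1) & D k = (true, [:: u])}.
  move=> k; rewrite !inE => /and3P[kS /andP[kl kh]].
  case: (D_left kl) kh kS => [->|[u hu ->]] //= _; rewrite !andbT => hau huf.
  by exists u => //; rewrite huf.
have {}cB : #|B| <= size [seq u <- f | a u.2 != u.1].
  apply: card_le_seq (S_inj _ _ hB) _ => k /hB[u /andP[h1 h2] ->] /=.
  by rewrite mem_filter h2.
apply: leq_ltn_trans cB _.
case: (altP (f =P [::])) => [->|/eqP fn] /=.
  apply: leq_trans (subset_leq_card (subsetUl _ _)); by rewrite cards2.
have /hasP[u uf hu] := a_hits fF fn.
have [k Dk] : exists k, D k = (true, [:: u]).
  by apply: D_ex; rewrite !inE mem_cat map_f ?orbT // (F_lits fF uf).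
have hsz : size [seq u <- f | a u.2 != u.1] <= 2.
  have := count_predC (fun u => a u.2 == u.1) f; rewrite size_filter.
  have := F_size fF; have : 0 < count (fun u => a u.2 == u.1) f by rewrite -has_count; apply/hasP; exists u.
  by move=> h1 h2 h3; rewrite -ltnS; apply: leq_trans h2; rewrite -h3 -addn1 addnC leq_add2r.
apply: leq_ltn_trans hsz _.
have sub : k |: [set A0; A1] \subset [set A0; A1] :|: [set j in S |
   (D j).1 && (D j != hub) && all (fun u => u \in f) (D j).2].
  rewrite subUset subsetUl andbT sub1set inE; apply/orP; right.
  by rewrite !inE Dk /= hu uf.
apply: leq_trans (subset_leq_card sub).
by rewrite cardsU1 -D_hub Dk cards2.
Qed.

End Forward.

Section Backward.

Variable S : {set vertex G}.
Hypothesis S_alliance : offensive_alliance S.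
Hypothesis S_size : #|S| <= n + 2.

Let deg_ge (i j : vertex G) : i \notin S -> j \in S -> adj i j ->
  deg_in (~: S) i < deg_in S i.
Proof.
move=> iS jS ij; rewrite -addn1; apply: (S_alliance.2); rewrite !inE iS.
by apply/exists_inP; exists j => //; rewrite adj_sym.
Qed.

Let deg_split i : deg_in S i + deg_in (~: S) i = #|[set j | adj i j]|.
Proof.
rewrite -(cardsID S [set j | adj i j]); congr (_ + _); apply: eq_card => j; rewrite !inE //.
by rewrite andbC.
Qed.

(* A hub has more than [2 * (n + 2)] neighbours, too many for an outside
   vertex of the neighbourhood of [S]. *)
Let hubs_of_right i : i \in S -> ~~ (D i).1 -> [set A0; A1] \subset S.
Proof.
move=> iS ir; apply/subsetP => j; rewrite -D_hub => /eqP Dj.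
apply/negPn/negP => jS; have adj_j k : adj j k = ~~ (D k).1.
  by rewrite adjE Dj /adjd /= andbT.
have := deg_ge jS iS; rewrite adj_j => /(_ ir); have := deg_split j.
have -> : #|[set k | adj j k]| = size F.
  by rewrite -card_right; apply: eq_card => k; rewrite !inE adj_j.
have : deg_in S j <= #|S|.
  by apply: subset_leq_card; apply/subsetP => k; rewrite inE => /andP[].
by have := S_size; have := F_large; lia.
Qed.

Let deg_right i f : D i = (false, f) -> #|[set j | adj i j]| <= 2 + size f.
Proof.
move=> Di; rewrite -(cardsID [set A0; A1]) leq_add //.
  by apply: leq_trans (subset_leq_card (subsetIr _ _)) _; rewrite cards2.
set B := (X in #|pred_of_set X| <= _).
have hB : {in B, forall k, exists2 u, u \in f & D k = (true, [:: u])}.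
  move=> k; rewrite in_setD -D_hub inE (adj_right k Di) => /and3P[kh kl].
  by case: (D_left kl) kh => [->|[u hu ->]] //= _; rewrite andbT => huf; exists u.
apply: (@card_le_seq _ _ _ (fun j => head (true, 0) (D j).2)).
  move=> j k /hB[u _ hu] /hB[w _ hw]; rewrite hu hw /= => e.
  by apply: (@D_lit _ _ u) => //; rewrite hw e.
by move=> k /hB[u uf ->].
Qed.

(** A vertex carrying the empty clause has exactly the hubs as neighbours. If it lies outside [S],
    one hub inside is no strict majority without the other; if it lies inside, [hubs_of_right]
    applies. *)
Let hubs_both : S :&: [set A0; A1] != finset.set0 -> [set A0; A1] \subset S.
Proof.
case/set0Pn => j /setIP[jS]; rewrite -D_hub => /eqP Dj.
have [z Dz] : exists z, D z = (false, [::]).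
  by apply: D_ex; rewrite !inE mem_cat map_f ?orbT.
have [zS|zS] := boolP (z \in S); first by apply: (hubs_of_right zS); rewrite Dz.
have hd := deg_ge zS jS; rewrite (adj_right _ Dz) Dj in hd.
apply/negPn/negP => hn; have : 0 < deg_in (~: S) z.
  have /subsetPn[k kh kS] := hn.
  rewrite card_gt0; apply/set0Pn; exists k; move: kh; rewrite -D_hub in_set in_setC kS (adj_right _ Dz) => /eqP ->.
  by [].
by have := hd isT; have := deg_split z; have := deg_right Dz; rewrite /=; lia.
Qed.

(** It remains to treat a literal in [S]. The pair vertex of its variable has four neighbours; if it
    is outside [S], at most one of them is, so some hub is inside. *)
Let hubs_in : [set A0; A1] \subset S.
Proof.
have [/set0Pn[w wS] _] := S_alliance.
have [wr|wr] := boolP (D w).1; last exact: hubs_of_right wS wr.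
have [Dw|[u hu Dw]] := D_left wr.
  by apply: hubs_both; apply/set0Pn; exists w; rewrite inE wS -D_hub Dw eqxx.
set f := [:: (true, u.2); (false, u.2)].
have [p Dp] : exists p, D p = (false, f).
  by apply: D_ex; rewrite !inE mem_cat map_f ?orbT // F_pair // -mem_lits.
have [pS|pS] := boolP (p \in S); first by apply: (hubs_of_right pS); rewrite Dp.
have hd := deg_ge pS wS; rewrite (adj_right _ Dp) Dw /= in hd.
have {}hd : deg_in (~: S) p < deg_in S p.
  by apply: hd; rewrite /f; case: (u) => [[] v]; rewrite !inE /= !eqxx ?orbT.
apply: hubs_both; apply/negP => /eqP hS; have : 2 <= deg_in (~: S) p.
  have -> : 2 = #|[set A0; A1]| by rewrite cards2.
  apply: subset_leq_card; apply/subsetP => j hj; rewrite in_set in_setC (adj_right _ Dp).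
  move: (hj); rewrite -D_hub => /eqP ->; rewrite andbT.
  by apply/negP => jS; have : j \in S :&: [set A0; A1]; [rewrite inE jS|rewrite hS inE].
by have := deg_split p; have := deg_right Dp; rewrite /=; lia.
Qed.

(** If no literal of [f] were inside, at least two literals outside would balance the two hubs
    inside. This is why a clause must contain two distinct literals. *)
Let hit i f : D i = (false, f) -> f \in F -> f <> [::] -> i \notin S ->
  exists u j, [/\ u \in f, j \in S & D j = (true, [:: u])].
Proof.
move=> Di fF fn iS; have [x [y [xf yf xy]]] := F_two fF fn.
have A0S : A0 \in S by rewrite (subsetP hubs_in) // !inE eqxx.
have hd : deg_in (~: S) i < deg_in S i.
  apply: (deg_ge iS A0S); rewrite (adj_right _ Di).
  by have := D_hub A0; rewrite !inE eqxx => /eqP ->.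
case E: ([set j in S | (D j).1 && (D j != hub) && all (fun u => u \in f) (D j).2]
  == finset.set0).
  exfalso; move: hd; rewrite {2}/deg_in (hub_in S Di) (eqP E) setU0.
  have hx w : w \in f -> exists2 j, D j = (true, [:: w]) & j \notin S.
    move=> wf; have [|j Dj] := @D_ex (true, [:: w]).
      by rewrite !inE mem_cat map_f ?orbT // (F_lits fF wf).
    exists j => //; apply/negP => jS.
    by move/eqP/setP: E => /(_ j); rewrite !inE jS Dj /= wf.
  have [j Dj jS] := hx _ xf; have [k Dk kS] := hx _ yf.
  have : 2 <= deg_in (~: S) i.
    have -> : 2 = #|[set j; k]|.
      by rewrite cards2; case: eqP => // e; case: xy; move: Dj; rewrite e Dk => -[].
    apply: subset_leq_card; apply/subsetP => l; rewrite in_set2 in_set in_setC (adj_right _ Di).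
    by case/orP => /eqP ->; rewrite ?jS ?kS ?Dj ?Dk /= ?xf ?yf.
  have : #|S :&: [set A0; A1]| <= 2.
    by apply: leq_trans (subset_leq_card (subsetIr _ _)) _; rewrite cards2.
  by move=> h1 h2 h3; have := leq_trans (leq_ltn_trans h2 h3) h1.
move/negbT/set0Pn: E => [j]; rewrite !inE => /and3P[jS /andP[jl jh]].
case: (D_left jl) jh => [->|[u hu Dj]]; first by rewrite eqxx.
by rewrite Dj /= andbT => _ uf; exists u, j.
Qed.

Let S' := S :\: [set A0; A1].

Let S'_size : #|S'| <= n.
Proof.
have := cardsID [set A0; A1] S; rewrite (_ : S :&: _ = [set A0; A1]); last exact/setIidPr.
rewrite cards2 -/S' => h; have := S_size; rewrite -h /=; lia.
Qed.

(** A clause vertex in [S] is read as the choice of its first literal. The default variable [n] is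
    out of range. *)
Let pick (i : vertex G) : lit := head (true, n) (D i).2.

Let pick_surj v : v < n -> exists2 j, j \in S' & (pick j).2 = v.
Proof.
move=> vn; have [p Dp] : exists p, D p = (false, [:: (true, v); (false, v)]).
  by apply: D_ex; rewrite !inE mem_cat map_f ?orbT // F_pair.
have [pS|pS] := boolP (p \in S).
  by exists p; rewrite /pick ?Dp //= inE pS -D_hub Dp.
have [||u [j [uf jS Dj]]] := hit Dp _ _ pS; [exact: F_pair|by []|].
exists j; first by rewrite inE jS -D_hub Dj.
by move: uf; rewrite /pick Dj !inE => /orP[] /eqP ->.
Qed.

(* [S'] picks a literal of each variable and has at most [n] elements. *)
Let pick_inj : {in S' &, injective (fun j => (pick j).2)}.
Proof.
apply/dinjectiveP; rewrite /dinjectiveb.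
apply: (@leq_size_uniq _ (iota 0 n)); first exact: iota_uniq.
  move=> v; rewrite mem_iota => /= /pick_surj[j jS <-].
  by apply/mapP; exists j => //; rewrite mem_enum.
rewrite size_map -cardE size_iota; exact: S'_size.
Qed.

(** Injectivity makes the picked literals consistent, hence true under the assignment read off from
    them. A clause with its vertex in [S] contains its own pick; any other non-empty clause contains
    a literal in [S] by [hit]. *)
Lemma assignment_of_alliance : exists a : nat -> bool,
  forall f, f \in F -> f <> [::] -> has (fun u => a u.2 == u.1) f.
Proof.
exists (fun v => [exists j in S', pick j == (true, v)]) => f fF fn.
have key j : j \in S' -> [exists k in S', pick k == (true, (pick j).2)] == (pick j).1.
  move=> jS; case E: (pick j) => [[] v] /=; rewrite ?eqb_id ?eqbF_neg.
    by apply/exists_inP; exists j; rewrite ?E.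
  apply/negP => /exists_inP[k kS /eqP hk].
  have e : k = j by apply: (pick_inj kS jS); rewrite hk E.
  by rewrite e E in hk.
have [i Di] : exists i, D i = (false, f).
  by apply: D_ex; rewrite !inE mem_cat map_f ?orbT.
have [iS|iS] := boolP (i \in S).
  have iS' : i \in S' by rewrite inE iS -D_hub Di.
  apply/hasP; exists (pick i); last exact: key.
  by rewrite /pick Di /=; case: (f) fn => // u l _; exact: mem_head.
have [u [j [uf jS Dj]]] := hit Di fF fn iS.
apply/hasP; exists u => //; have := @key j; rewrite /pick Dj /=; apply.
by rewrite inE jS -D_hub Dj.
Qed.

End Backward.
End Alliance.

(** * The algorithm for 3-SAT *)

Definition triple : Type := lit * lit * lit.
Definition lit0 : lit := (true, 0).

(* An empty clause becomes two contradictory clauses on the fresh variable [n]. *)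
Definition norm_clause n (c : seq lit) : seq triple :=
  if nilp c then [:: ((true, n), (true, n), (true, n)); ((false, n), (false, n), (false, n))]
  else [:: (head lit0 c, head lit0 (behead c ++ c), head lit0 (behead (behead c) ++ c))].

Definition perms3 (t : triple) : seq triple :=
  [:: t; (t.1.1, t.2, t.1.2); (t.1.2, t.1.1, t.2); (t.1.2, t.2, t.1.1);
      (t.2, t.1.1, t.1.2); (t.2, t.1.2, t.1.1)].

(** Replaces the dependent literals by plain data with the same tree, so that the [polytime] lemmas
    apply. *)
Definition plain_cnf (phi : cnf) : nat * seq (seq lit) :=
  (nvars phi, [seq [seq (l.2, nat_of_ord l.1) | l <- c] | c <- clauses phi]).

(** The [n.+1] variables include the fresh one for empty clauses. Filtering the list of all triples
    removes repetitions and makes the range of the literals immediate; the permutations provide the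
    symmetry that the degree counts rely on. *)
Definition context (x : nat * seq (seq lit)) : nat * seq triple :=
  (x.1, [seq t <- [seq (p, c) | p <- pairs (lits x.1.+1), c <- lits x.1.+1] |
          t \in flatten [seq perms3 t | t <- flatten [seq norm_clause x.1 c | c <- x.2]]]).

Definition clause_family (n : nat) (C : seq triple) (X : state lit) : seq (seq lit) :=
  let L := lits n.+1 in
  [seq [:: u] | u <- X.1] ++
  [seq [:: p.1; p.2] | p <- pairs L & active2 X.1 X.2 p] ++
  [seq [:: x.1; x.2.1; x.2.2] | x <- [seq (a, p) | a <- L, p <- pairs L] &
     active3 C X.1 X.2 (x.1, x.2.1, x.2.2)].

(* A right vertex with a single literal would be satisfied by the hubs alone. *)
Definition split_unit (v : nat) (f : seq lit) : seq (seq lit) :=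
  if all (fun u => u == head lit0 f) f
  then [:: [:: (true, v); head lit0 f]; [:: (false, v); head lit0 f]] else [:: f].

(** Variable [n] is the one for empty clauses and [n.+1] the one for unit clauses, whence [n.+2]
    pair clauses. The [2 * n.+2 + 5] empty clauses alone outnumber twice the size bound [n.+4], as
    the hubs require; that bound is two hubs plus one literal per variable. *)
Definition instance_family (n : nat) (C : seq triple) (X : state lit) : seq (seq lit) :=
  [seq [:: (true, v); (false, v)] | v <- iota 0 n.+2] ++
  flatten [seq split_unit n.+1 f | f <- clause_family n C X] ++
  [:: [::]; [::]; [::]; [::]; [::]] ++ [seq [::] | _ <- lits n.+2].

Definition instance_of (n : nat) (C : seq triple) (X : state lit) : graph * nat :=
  (graph_of (verts n.+2 (instance_family n C X)), n.+4).

Definition plain_instance (n : nat) (C : seq triple) (X : state lit) : seq (seq bool) * nat :=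
  let V := verts n.+2 (instance_family n C X) in ([seq [seq adjd x y | y <- V] | x <- V], n.+4).

(** Both the branching and the final instance are computed at every node, at polynomial cost; an
    empty list of branches tells the loop to use the instance. *)
Definition stage th th3 (x : nat * seq triple * state lit) :=
  (step th th3 (lits x.1.1.+1) x.1.2 x.2, plain_instance x.1.1 x.1.2 x.2).

(** * Encodings and polynomial time of the reduction *)

Lemma enc_seq_map (A B : Type) (f : A -> B) (eA : A -> tree) (eB : B -> tree) s :
  (forall a, eB (f a) = eA a) -> enc_seq eB (map f s) = enc_seq eA s.
Proof. by move=> h; elim: s => [//|a s IH]; rewrite /= h IH. Qed.

Lemma enc_plain_cnf phi : enc_cnf phi = enc (plain_cnf phi).
Proof.
congr Node; symmetry; apply: enc_seq_map => c; exact: enc_seq_map.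
Qed.

Lemma enc_plain_instance n C X :
  enc_instance (instance_of n C X) = enc (plain_instance n C X).
Proof.
rewrite /enc_instance /instance_of /plain_instance; set V := verts _ _.
congr Node; rewrite /enc_graph.
suff h (T : Type) (f : desc -> T) :
    [seq f (nth hub V (i : 'I_(size V))) | i <- enum 'I_(size V)] = map f V.
  rewrite -h; congr enc_seq; apply: eq_map => i.
  by rewrite -h.
rewrite -[in RHS](mkseq_nth hub V) /mkseq -val_enum_ord -!map_comp.
by apply: eq_map.
Qed.

Lemma polytime_lits A {EA : Enc A} (f : A -> nat) :
  polytime f -> polytime (fun x => lits (f x)).
Proof.
move=> hf; apply: (@eq_polytime _ _ _ _ (fun x =>
  map (pair true) (iota 0 (f x)) ++ map (pair false) (iota 0 (f x)))).
  by refine (polytime_comp (f := f) (g := fun n => map (pair true) (iota 0 n) ++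
    map (pair false) (iota 0 n)) hf _); repeat polytime_step.
by move=> x; rewrite /lits -lock.
Qed.

Ltac polytime_solve := repeat
  first [ lazymatch goal with
          | |- polytime (fun x => lits (@?f x)) => refine (polytime_lits (f := f) _); cbv beta
          end
        | polytime_step ].

Lemma polytime_context : polytime context.
Proof. by rewrite /context /pairs /norm_clause /perms3; polytime_solve. Qed.

Lemma polytime_stage th th3 : polytime (stage th th3).
Proof.
rewrite /stage /step /plain_instance /verts /instance_family /clause_family /split_unit /adjd.
rewrite /petals_a /petals_b /petals_c /grow1 /grow2 /active2 /active3 /pairs /hub.
by polytime_solve.
Qed.

(** * Satisfiability is preserved *)

Definition lit_sat (a : nat -> bool) : pred lit := fun u => a u.2 == u.1.

Definition triple_sat (h : pred lit) (t : triple) := [|| h t.1.1, h t.1.2 | h t.2].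

Lemma mem_context x t : (t \in (context x).2) =
  (t \in flatten [seq perms3 t | t <- flatten [seq norm_clause x.1 c | c <- x.2]]) &&
  (t \in [seq (p, c) | p <- pairs (lits x.1.+1), c <- lits x.1.+1]).
Proof. by rewrite mem_filter. Qed.

Lemma context_lits x t : t \in (context x).2 ->
  [/\ t.1.1 \in lits x.1.+1, t.1.2 \in lits x.1.+1 & t.2 \in lits x.1.+1].
Proof.
rewrite mem_context => /andP[_ /allpairsP[[p c] /= [hp hc ->]]] /=.
by case: p hp => a b; rewrite mem_pairs => /andP[].
Qed.

Lemma context_sym x a b c : (a, b, c) \in (context x).2 ->
  (b, a, c) \in (context x).2 /\ (a, c, b) \in (context x).2.
Proof.
move=> h; have [/= ha hb hc] := context_lits h.
have hL u v w : u \in lits x.1.+1 -> v \in lits x.1.+1 -> w \in lits x.1.+1 ->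
    (u, v, w) \in [seq (p, c) | p <- pairs (lits x.1.+1), c <- lits x.1.+1].
  by move=> hu hv hw; apply/allpairsP; exists ((u, v), w); rewrite mem_pairs hu hv.
move: h; rewrite !mem_context !hL // !andbT => /flatten_mapP[t ht hp].
split; apply/flatten_mapP; exists t => //; case: t hp {ht} => [[u v] w]; rewrite !inE /=.
- by do 5?[case/orP]; move/eqP => [-> -> ->]; rewrite !eqxx ?orbT.
- by do 5?[case/orP]; move/eqP => [-> -> ->]; rewrite !eqxx ?orbT.
Qed.

(** The copy of [c] appended in [norm_clause] pads a short clause with its first literal; for the
    empty clause, the two triples contradict each other on variable [n]. *)
Lemma norm_clause_sat n a (c : seq lit) : size c <= 3 ->
  all (triple_sat (lit_sat a)) (norm_clause n c) = has (lit_sat a) c.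
Proof.
case: c => [|u [|v [|w [|]]]] //= _; rewrite /triple_sat /lit_sat /= ?andbT ?orbF ?orbb //.
  by case: (a n).
by case: (_ == u.1); rewrite /= ?orbT ?orbF.
Qed.

Lemma norm_clause_lits n (c : seq lit) t : (forall u, u \in c -> u.2 < n) ->
  t \in norm_clause n c -> t \in [seq (p, c) | p <- pairs (lits n.+1), c <- lits n.+1].
Proof.
move=> hc ht; have h0 b : (b, n) \in lits n.+1 by rewrite mem_lits /=.
have hL u v w : u \in lits n.+1 -> v \in lits n.+1 -> w \in lits n.+1 ->
    (u, v, w) \in [seq (p, c) | p <- pairs (lits n.+1), c <- lits n.+1].
  by move=> hu hv hw; apply/allpairsP; exists ((u, v), w); rewrite mem_pairs hu hv.
have hm u : u \in c -> u \in lits n.+1 by move=> /hc; rewrite mem_lits; exact: ltnW.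
have hhd s : s <> [::] -> {subset s <= c} -> head lit0 s \in lits n.+1.
  by case: s => // u s _ /(_ u (mem_head _ _)) /hm.
have hcat s : c <> [::] -> s ++ c <> [::] by case: s.
move: ht; rewrite /norm_clause; case: nilP => [_|/eqP hn] ht.
  by rewrite !inE in ht; case/orP: ht => /eqP ->; apply: hL.
rewrite inE in ht; move/eqP: ht => ->; have {}hn : c <> [::] by apply/eqP.
apply: hL; apply: hhd => //; try exact: hcat.
- by move=> u; rewrite mem_cat => /orP[/mem_behead|].
- by move=> u; rewrite mem_cat => /orP[/mem_behead/mem_behead|].
Qed.

Lemma context_sat n (cl : seq (seq lit)) a :
  (forall c, c \in cl -> size c <= 3 /\ forall u, u \in c -> u.2 < n) ->
  sat (lit_sat a) (context (n, cl)).2 ([::], [::]) = all (has (lit_sat a)) cl.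
Proof.
move=> hcl; have mC := mem_context (n, cl).
set h := lit_sat a; move: (context (n, cl)).2 mC => C mC; rewrite /sat /=.
apply/allP/allP => [hC c hc|hc t].
  have [sc lc] := hcl _ hc; rewrite -(norm_clause_sat n) //; apply/allP => t ht.
  apply: hC; rewrite mC (norm_clause_lits lc ht) andbT.
  apply/flatten_mapP; exists t; last exact: mem_head.
  by apply/flatten_mapP; exists c.
rewrite mC => /andP[/flatten_mapP[t0 /flatten_mapP[c cc ht0] ht] _].
have [sc _] := hcl _ cc; have := hc _ cc.
rewrite -(norm_clause_sat n) // => /allP/(_ _ ht0).
move: ht; case: t0 {ht0} => [[u v] w]; rewrite !inE /triple_sat /= -/h.
by do 5?[case/orP]; move/eqP => -> /=; case: (h u); case: (h v); case: (h w).
Qed.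

Lemma satisfiable_context phi : is_3cnf phi ->
  satisfiable phi <->
  exists a, sat (lit_sat a) (context (plain_cnf phi)).2 ([::], [::]).
Proof.
case: phi => n cl /allP h3; rewrite /satisfiable /plain_cnf /=.
have hcl c : c \in [seq [seq (l.2, nat_of_ord l.1) | l <- c] | c <- cl] ->
    size c <= 3 /\ forall u, u \in c -> u.2 < n.
  case/mapP => c' /h3 /= hc' ->; rewrite size_map; split=> // u.
  by case/mapP => l _ ->; exact: ltn_ord.
split=> [[a ha]|[a]]; last first.
  rewrite context_sat // all_map => ha; exists (fun i => a i); move: ha.
  by apply: sub_all => c /=; rewrite has_map.
exists (fun v => if insub v is Some i then a i else true).
rewrite context_sat // all_map; apply: sub_all ha => c /=; rewrite has_map.
by apply: sub_has => l /=; rewrite /lit_sat /= valK.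
Qed.

Section Instance.

Variables (n : nat) (C : seq triple) (X : state lit).
Hypothesis C_lits : forall t, t \in C ->
  [/\ t.1.1 \in lits n.+1, t.1.2 \in lits n.+1 & t.2 \in lits n.+1].
Hypothesis X1_lits : subseq X.1 (lits n.+1).
Hypothesis X2_lits : subseq X.2 (pairs (lits n.+1)).

Lemma clause_family_wf f : f \in clause_family n C X ->
  [/\ f <> [::], size f <= 3 & {subset f <= lits n.+1}].
Proof.
rewrite !mem_cat => /or3P[] /mapP[].
- move=> u /(mem_subseq X1_lits) hu ->; split=> // v; by rewrite inE => /eqP ->.
- move=> [a b]; rewrite mem_filter mem_pairs => /and3P[_ ha hb] ->; split=> // v.
  by rewrite !inE => /orP[] /eqP ->.
- move=> [a [b c]]; rewrite mem_filter => /andP[_ /allpairsP[[x p] /= [hx hp [-> e]]]] ->.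
  move: hp; rewrite -e mem_pairs => /andP[hb hc]; split=> // v.
  by rewrite !inE => /or3P[] /eqP ->.
Qed.

Lemma split_unit_wf f g : f <> [::] -> size f <= 3 -> {subset f <= lits n.+1} ->
  g \in split_unit n.+1 f ->
  [/\ size g <= 3, {subset g <= lits n.+2} &
      exists x y, [/\ x \in g, y \in g & x <> y]].
Proof.
move=> fn fs fl; have fl2 : {subset f <= lits n.+2}.
  by move=> u /fl; rewrite !mem_lits => /leqW.
have hhd : head lit0 f \in f by case: (f) fn => // u s _; exact: mem_head.
rewrite /split_unit; case: allP => hf.
  move=> hg; have [b ->] : exists b, g = [:: (b, n.+1); head lit0 f].
    by move: hg; rewrite !inE => /orP[] /eqP ->; [exists true|exists false].
  split=> //.
    move=> u hu; rewrite !inE in hu; case/orP: hu => /eqP ->; last exact: fl2.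
    by rewrite mem_lits /=.
  exists (b, n.+1), (head lit0 f); rewrite !inE !eqxx orbT; split=> // e.
  by have := fl _ hhd; rewrite -e mem_lits /= ltnn.
rewrite inE => /eqP ->; split=> //.
have /allPn[x xf /eqP hx] : ~~ all (fun u => u == head lit0 f) f by apply/allP.
by exists x, (head lit0 f).
Qed.

(** The two clauses on the fresh variable resolve to the single literal of [f], which may occur
    several times in [f]. *)
Lemma split_unit_sat a f : f <> [::] ->
  all (has (lit_sat a)) (split_unit n.+1 f) = has (lit_sat a) f.
Proof.
move=> fn; rewrite /split_unit; case: allP => hf; last by rewrite /= andbT.
have -> : has (lit_sat a) f = lit_sat a (head lit0 f).
  case: f fn hf => // u s _ /= hf; case hu: (lit_sat a u) => //=.
  apply/negbTE/hasPn => v vs; have /hf /eqP -> : v \in u :: s by rewrite inE vs orbT.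
  by rewrite hu.
by rewrite /= !orbF andbT /lit_sat /=; case: (a n.+1); rewrite ?orbT ?andbT.
Qed.

(** Only active clauses are listed. An inactive one contains a forced literal or, for a 3-clause, a
    2-clause of the state, so it holds as soon as these do. *)
Lemma clause_family_sat a :
  all (has (lit_sat a)) (clause_family n C X) = sat (lit_sat a) C X.
Proof.
set h := lit_sat a; rewrite /clause_family !all_cat !all_map /sat.
have -> : all (preim (fun u => [:: u]) (has h)) X.1 = all h X.1.
  by apply: eq_all => u /=; rewrite orbF.
case hU: (all h X.1) => //=; move/allP: hU => hU.
have -> : all (preim (fun p => [:: p.1; p.2]) (has h))
    [seq p <- pairs (lits n.+1) | active2 X.1 X.2 p] = all (fun p => h p.1 || h p.2) X.2.
  apply/allP/allP => hp p.
    move=> pX; have := hp p; rewrite mem_filter (mem_subseq X2_lits pX) andbT /= orbF.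
    rewrite /active2 pX /=; case: (boolP (_ \in X.1)) => [/hU ->//|_].
    by case: (boolP (_ \in X.1)) => [/hU ->|_ ->//]; rewrite orbT.
  by rewrite mem_filter /= orbF => /andP[/and3P[/hp]].
case hT: (all _ X.2) => //=; move/allP: hT => hT.
apply/allP/allP => hp t.
  case: t => [[x y] z] tC; have [/= hx hy hz] := C_lits tC.
  have := hp (x, (y, z)); rewrite mem_filter /= orbF.
  have -> : (x, (y, z)) \in [seq (a, p) | a <- lits n.+1, p <- pairs (lits n.+1)].
    by apply/allpairsP; exists (x, (y, z)); rewrite mem_pairs hx hy.
  rewrite /active3 /= tC /=.
  case: (boolP (x \in X.1)) => [/hU ->//|_].
  case: (boolP (y \in X.1)) => [/hU ->|_]; first by rewrite orbT.
  case: (boolP (z \in X.1)) => [/hU ->|_]; first by rewrite !orbT.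
  case: (boolP ((x, y) \in X.2)) => [/hT /= hxy|_]; first by rewrite orbA hxy.
  case: (boolP ((x, z) \in X.2)) => [/hT /= hxy|_]; first by rewrite orbCA hxy orbT.
  case: (boolP ((y, z) \in X.2)) => [/hT /= ->|_]; first by rewrite orbT.
  by move=> ->.
case: t => x [y z]; rewrite mem_filter => /andP[/and5P[/= /hp /=]].
by rewrite orbF.
Qed.

Let F := instance_family n C X.

Lemma mem_instance_family g : g \in F ->
  [\/ exists2 v, v < n.+2 & g = [:: (true, v); (false, v)],
      exists2 f, f \in clause_family n C X & g \in split_unit n.+1 f | g = [::]].
Proof.
rewrite !mem_cat => /or4P[/mapP[v]|/flatten_mapP[f hf hg]|hg|/mapP[u _ ->]].
- by rewrite mem_iota => hv ->; apply: Or31; exists v.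
- by apply: Or32; exists f.
- by apply: Or33; move: hg; rewrite !inE !orbb => /eqP.
- exact: Or33.
Qed.

Lemma instance_correct :
  has_offensive_alliance (instance_of n C X) <-> exists a, sat (lit_sat a) C X.
Proof.
have F_lits f u : f \in F -> u \in f -> u \in lits n.+2.
  case/mem_instance_family => [[v hv ->]|[g /clause_family_wf[h1 h2 h3] hf]|->//].
    by move=> hu; rewrite !inE in hu; case/orP: hu => /eqP ->; rewrite mem_lits.
  by have [_ hl _] := split_unit_wf h1 h2 h3 hf; exact: hl.
have F_size f : f \in F -> size f <= 3.
  case/mem_instance_family => [[v hv ->//]|[g /clause_family_wf[h1 h2 h3] hf]|->//].
  by have [] := split_unit_wf h1 h2 h3 hf.
have F_two f : f \in F -> f <> [::] -> exists x y, [/\ x \in f, y \in f & x <> y].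
  case/mem_instance_family => [[v hv ->]|[g /clause_family_wf[h1 h2 h3] hf]|->//] fn.
    by exists (true, v), (false, v); split; rewrite ?inE ?eqxx ?orbT.
  by have [] := split_unit_wf h1 h2 h3 hf.
have F_nil : [::] \in F by rewrite !mem_cat; apply/or4P/Or43/mem_head.
have F_pair v : v < n.+2 -> [:: (true, v); (false, v)] \in F.
  by move=> hv; rewrite mem_cat map_f // mem_iota.
have F_large : 2 * (n.+2 + 2) < size F.
  by rewrite /F /instance_family !size_cat !size_map size_lits size_iota /=; lia.
have F_sat a : (forall f, f \in F -> f <> [::] -> has (lit_sat a) f) <-> sat (lit_sat a) C X.
  rewrite -clause_family_sat; split=> [h|/allP h f].
    apply/allP => f hf; have [h1 h2 h3] := clause_family_wf hf.
    rewrite -split_unit_sat //; apply/allP => g hg; apply: h.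
      by rewrite !mem_cat; apply/or4P/Or42/flatten_mapP; exists f.
    by have [_ _ [x [y [hx _ _]]]] := split_unit_wf h1 h2 h3 hg => e; rewrite e in hx.
  case/mem_instance_family => [[v hv ->] _|[g hg hf] _|->//].
    by rewrite /= /lit_sat /=; case: (a v).
  have [h1 _ _] := clause_family_wf hg; have := h _ hg.
  by rewrite -split_unit_sat // => /allP; apply.
rewrite /instance_of -/F -[n.+4]addn2; split.
  case=> S [hS /andP[_ hs]].
  have [a ha] := assignment_of_alliance F_lits F_two F_nil F_pair F_large hS hs.
  by exists a; apply/F_sat.
case=> a /F_sat ha; exact: (alliance_of_assignment F_lits F_size ha).
Qed.

Lemma gorderE : gorder (instance_of n C X).1 = 2 + 2 * n.+2 + size F.
Proof. exact: size_verts. Qed.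

(** Each clause splits into at most two, which gives [4 * (1 + th + th3) * n.+1]. Hubs, literals,
    pair clauses and empty clauses add [5 * n.+1 + 12], at most [17 * n.+1]. *)
Lemma gorder_le th th3 : sparse th th3 (lits n.+1) C X ->
  gorder (instance_of n C X).1 <= (21 + 4 * (th + th3)) * n.+1.
Proof.
rewrite gorderE; case; rewrite size_lits => h2 h3.
have h1 : size X.1 <= 2 * n.+1 by rewrite -size_lits; exact: size_subseq.
have hcf : size (clause_family n C X) <= 2 * n.+1 + 2 * n.+1 * th + 2 * n.+1 * th3.
  rewrite !size_cat !size_map !size_filter -addnA; apply: leq_add => //; exact: leq_add.
have hsp : size (flatten [seq split_unit n.+1 f | f <- clause_family n C X]) <=
    2 * size (clause_family n C X).
  elim: (clause_family _ _ _) => //= f s IH; rewrite size_cat mulnS leq_add //.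
  by rewrite /split_unit; case: ifP.
rewrite /F /instance_family !size_cat !size_map size_lits size_iota.
have {}hsp := leq_trans hsp (leq_mul (leqnn 2) hcf).
move: hsp; set s := size (flatten _); set k := size [:: _; _; _; _; _].
have -> : k = 5 by [].
clear; nia.
Qed.

End Instance.

(* Variable 0 holds the answer so far, 1 the context, 2 the stack of states to
   explore; the variables from 3 on are scratch. *)
Definition loop_body (cst : nat -> com) (p : com) : com :=
  Seq (Assign 3 (Cons (Var 1) (Hd (Var 2))))
  (Seq (Assign 2 (Tl (Var 2)))
  (Seq (cst 3)
  (If (Hd (Var 3))
    (Assign 2 (Cons (Hd (Hd (Var 3))) (Cons (Hd (Tl (Hd (Var 3)))) (Var 2))))
    (Seq (Assign 3 (Tl (Var 3)))
    (Seq (subroutine 3 p)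
     (If (Var 3) (Assign 0 (Cons Nil Nil)) (Assign 0 (Var 0)))))))).

Section Body.

Variables (th th3 : nat) (cst : nat -> com) (k : nat).
Hypothesis cstP : forall j (a : nat * seq triple * state lit) s, s j = enc a ->
  exists t s', [/\ exec (cst j) s t s', s' j = enc (stage th th3 a),
    forall i, i < j -> s' i = s i, t <= (esize a).+2 ^ k &
    esize (stage th th3 a) <= (esize a).+2 ^ k].

Variables (p : com) (n : nat) (C : seq triple).

(** Stated for an arbitrary continuation [c], since branching and stopping share this prefix of the
    body. *)
Let stage_exec X (r : seq (state lit)) s : s 1 = enc (n, C) -> s 2 = enc (X :: r) ->
  exists t s', [/\ forall c s2 t2, exec c s' t2 s2 ->
      exec (Seq (Assign 3 (Cons (Var 1) (Hd (Var 2)))) (Seq (Assign 2 (Tl (Var 2)))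
        (Seq (cst 3) c))) s (8 + t + t2) s2,
    s' 3 = enc (stage th th3 (n, C, X)), s' 0 = s 0 /\ s' 1 = s 1, s' 2 = enc r &
    t <= (esize (n, C, X)).+2 ^ k].
Proof.
move=> s1 s2.
pose q := upd (upd s 3 (Node (s 1) (tree_hd (s 2)))) 2 (tree_tl (s 2)).
have [|t [s' [e1 e2 e3 e4 _]]] := @cstP 3 (n, C, X) q.
  by rewrite /q /upd /= s1 s2.
exists t, s'; split=> //.
- move=> c s3 t2 ec; rewrite (_ : 8 + t + t2 = 5 + (3 + (t + t2))); last by lia.
  apply: exec_seq; first exact: (exec_assign 3 (Cons (Var 1) (Hd (Var 2)))).
  apply: exec_seq; first exact: (exec_assign 2 (Tl (Var 2))).
  exact: exec_seq e1 ec.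
- by rewrite !e3.
- by rewrite e3 // /q /upd /= s2.
Qed.

Lemma body_branch X X1 X2 r s : s 1 = enc (n, C) -> s 2 = enc (X :: r) ->
  step th th3 (lits n.+1) C X = [:: X1; X2] ->
  exists t s', [/\ exec (loop_body cst p) s t s', s' 0 = s 0, s' 1 = s 1,
    s' 2 = enc [:: X1, X2 & r] & t <= 40 + (esize (n, C, X)).+2 ^ k].
Proof.
move=> s1 s2 hstep; have [t [s' [ex e3 [e0 e1] e2 ht]]] := stage_exec s1 s2.
rewrite /stage /= hstep in e3.
exists (8 + t + (3 + 11)), (upd s' 2
  (eval s' (Cons (Hd (Hd (Var 3))) (Cons (Hd (Tl (Hd (Var 3)))) (Var 2))))); split.
- apply: ex; apply: (@exec_if_true (Hd (Var 3))); first by rewrite /= e3.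
  exact: (exec_assign 2 (Cons (Hd (Hd (Var 3))) (Cons (Hd (Tl (Hd (Var 3)))) (Var 2)))).
- by rewrite /upd /= e0.
- by rewrite /upd /= e1.
- by rewrite /upd /= e3 e2.
- apply: leq_trans (leq_add (leqnn 40) ht); clear; lia.
Qed.

Lemma body_stop X r s tp y : s 1 = enc (n, C) -> s 2 = enc (X :: r) ->
  step th th3 (lits n.+1) C X = [::] ->
  runs p (enc_instance (instance_of n C X)) tp y ->
  exists t s', [/\ exec (loop_body cst p) s t s',
    s' 0 = (if y is Node _ _ then Node Leaf Leaf else s 0), s' 1 = s 1,
    s' 2 = enc r & t <= 40 + (esize (n, C, X)).+2 ^ k + 2 * (cvars p).+1 + tp].
Proof.
move=> s1 s2 hstep hrun; have [t [s' [ex e3 [e0 e1] e2 ht]]] := stage_exec s1 s2.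
rewrite /stage /= hstep in e3.
pose q := upd s' 3 (tree_tl (s' 3)).
have [|q' [ep f3 f]] := exec_subroutine (k := 3) (s := q) hrun.
  by rewrite enc_plain_instance /q /upd /= e3.
exists (8 + t + (3 + (3 + (2 * (cvars p).+1 + tp + (if y is Node _ _ then 6 else 4))))),
  (upd q' 0 (if y is Node _ _ then Node Leaf Leaf else q' 0)); split.
- apply: ex; apply: (@exec_if_false (Hd (Var 3))); first by rewrite /= e3.
  apply: exec_seq; first exact: (exec_assign 3 (Tl (Var 3))).
  apply: exec_seq ep _; case: y f3 {hrun} => [|l r'] f3.
    by apply: (@exec_if_false (Var 3)) => //; exact: (exec_assign 0 (Var 0)).
  apply: (@exec_if_true (Var 3)); first by rewrite /= f3.
  exact: (exec_assign 0 (Cons Nil Nil)).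
- by rewrite /upd /= f // /q /upd /= e0.
- by rewrite /upd /= f // /q /upd /= e1.
- by rewrite /upd /= f // /q /upd /= e2.
- have h1 : (if y is Node _ _ then 6 else 4) <= 6 by case: (y).
  move: h1 ht; move: (if y is Node _ _ then 6 else 4) (_ ^ k); clear; lia.
Qed.

End Body.

(** * Running time *)

Local Open Scope ring_scope.

Lemma bernoulli_ineq (R : realType) (x : R) m : -1 <= x -> 1 + x *+ m <= (1 + x) ^+ m.
Proof.
move=> hx; elim: m => [|m IH]; first by rewrite mulr0n addr0 expr0.
have h : (1 + x *+ m) * (1 + x) <= (1 + x) ^+ m.+1.
  by rewrite exprSr ler_wpM2r //; lra.
apply: le_trans h; rewrite mulrSr.
have : 0 <= x * x *+ m by rewrite mulrn_wge0 // -expr2 sqr_ge0.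
rewrite mulrDr mulr1 mulrDl mul1r -mulrnAl; lra.
Qed.

(* The potential of the initial state is [4 * th] times the number of literals,
   whence [be ^+ (4 * th) = al]. *)
Lemma thresholds_exist (R : realType) (e : R) : 0 < e ->
  exists (th th3 : nat) (al be : R),
  [/\ (0 < th)%N && (0 < th3)%N, 1 <= be, be <= al, be ^+ (4 * th) = al /\ al = 2 `^ e &
      al^-1 + be^-1 ^+ th3 <= 1 /\ be^-1 + al^-1 ^+ th <= 1].
Proof.
move=> e0; pose al : R := 2 `^ e; pose ga : R := 2 `^ (e / 2).
have gt1 (x : R) : 0 < x -> 1 < 2 `^ x.
  move=> hx; apply: le_lt_trans (_ : 1 <= 1 `^ x) _; first by rewrite powR1.
  by apply: gt0_ltr_powR; rewrite // ?nnegrE; lra.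
have al1 : 1 < al by exact: gt1.
have ga1 : 1 < ga by apply: gt1; lra.
have gaal : ga ^+ 2 = al.
  by rewrite -powR_mulrn ?powR_ge0 // -powRrM; congr powR; field.
have ai1 : al^-1 < 1 by rewrite invf_lt1 //; lra.
have ai0 : 0 < al^-1 by rewrite invr_gt0; lra.
have large (x : R) : exists m : nat, x < m%:R.
  by exists (Num.trunc x).+1; exact: truncnS_gt.
(* Since [be ^ (4 th) = al], Bernoulli gives only [1 - be^-1 >= (1 - al^-1) / (4 th)]. Applied to
   the square root [ga] of [al], it gives [al ^ th >= (th (ga - 1)) ^ 2]; the quadratic growth beats
   the lost factor [th], so the product of both exceeds 1 for [th] this large. *)
have [th hth] := large (4 / ((1 - al^-1) * (ga - 1) ^+ 2)).
have q0 : 0 < (1 - al^-1) * (ga - 1) ^+ 2.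
  by apply: mulr_gt0; [lra|apply: exprn_gt0; lra].
rewrite ltr_pdivrMr // in hth.
have th0 : (0 < th)%N by case: th hth => //; rewrite mul0r; lra.
have th0R : 0 < th%:R :> R by rewrite ltr0n.
pose be : R := 2 `^ (e / (4 * th%:R)).
have be1 : 1 < be by apply: gt1; apply: divr_gt0 => //; apply: mulr_gt0.
have beal : be ^+ (4 * th) = al.
  rewrite -powR_mulrn ?powR_ge0 // -powRrM; congr powR; rewrite natrM.
  by field; rewrite gt_eqF.
have bi1 : be^-1 < 1 by rewrite invf_lt1 //; lra.
have bi0 : 0 < be^-1 by rewrite invr_gt0; lra.
(* By Bernoulli [be ^ th3 >= th3 (be - 1)], so this choice gives [be^-1 ^ th3 <= 1 - al^-1]. It
   follows the choice of [th], on which [be] depends. *)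
have [th3 hth3] := large (1 / ((1 - al^-1) * (be - 1))).
have q1 : 0 < (1 - al^-1) * (be - 1) by apply: mulr_gt0; lra.
rewrite ltr_pdivrMr // in hth3.
have th30 : (0 < th3)%N by case: th3 hth3 => //; rewrite mul0r; lra.
exists th, th3, al, be; split.
- by rewrite th0.
- exact: ltW.
- rewrite ler_powR //; first lra.
  rewrite ler_pdivrMr; last by apply: mulr_gt0.
  rewrite ler_peMr //; first exact: ltW.
  have : 1 <= th%:R :> R by rewrite ler1n.
  by lra.
- by [].
split.
  have h1 : th3%:R * (be - 1) <= be ^+ th3.
    have := @bernoulli_ineq R (be - 1) th3; rewrite -mulr_natl [1 + (be - 1)]addrC subrK => h.
    by apply: le_trans (h _); lra.
  have p0 : 0 < be ^+ th3 by apply: exprn_gt0; lra.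
  suff : be^-1 ^+ th3 <= 1 - al^-1 by lra.
  rewrite exprVn -[X in X <= _]mul1r ler_pdivrMr //.
  have : (1 - al^-1) * (th3%:R * (be - 1)) <= (1 - al^-1) * be ^+ th3.
    by apply: ler_wpM2l => //; lra.
  by rewrite mulrCA; lra.
have h1 : (th%:R * (ga - 1)) ^+ 2 <= al ^+ th.
  rewrite -gaal -exprM mulnC exprM; apply: lerXn2r; rewrite ?nnegrE.
  - by apply: mulr_ge0; lra.
  - by apply: exprn_ge0; lra.
  - have := @bernoulli_ineq R (ga - 1) th; rewrite -mulr_natl [1 + (ga - 1)]addrC subrK => h.
    by apply: le_trans (h _); lra.
have h2 : (1 - al^-1) <= (1 - be^-1) * (4 * th%:R).
  have := @bernoulli_ineq R (be^-1 - 1) (4 * th)%N.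
  rewrite -[(be^-1 - 1) *+ _]mulr_natl [1 + (be^-1 - 1)]addrC subrK exprVn beal natrM => h.
  by have := h ltac:(lra); lra.
have p0 : 0 < al ^+ th by apply: exprn_gt0; lra.
suff : al^-1 ^+ th <= 1 - be^-1 by lra.
rewrite exprVn -[X in X <= _]mul1r ler_pdivrMr //.
have h3 : (1 - be^-1) * (th%:R * (ga - 1)) ^+ 2 <= (1 - be^-1) * al ^+ th.
  by apply: ler_wpM2l => //; lra.
apply: le_trans h3; rewrite exprMn.
set x2 := (ga - 1) ^+ 2 in hth q0 *.
have x20 : 0 <= x2 by apply: sqr_ge0.
have h4 : (1 - al^-1) * (th%:R * x2) <= (1 - be^-1) * (4 * th%:R) * (th%:R * x2).
  by apply: ler_wpM2r => //; apply: mulr_ge0 => //; exact: ltW.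
have -> : (1 - be^-1) * (th%:R ^+ 2 * x2) = (1 - be^-1) * (4 * th%:R) * (th%:R * x2) / 4.
  by set B := 1 - be^-1; field.
rewrite ler_pdivlMr // mul1r.
apply: le_trans h4; rewrite mulrCA; exact: ltW.
Qed.

Definition weight (R : realType) th (al be : R) (L : seq lit) (X : state lit) : R :=
  al ^+ num1 L X.1 * be ^+ pot th L X.

Section Weight.

Variables (R : realType) (th th3 : nat) (al be : R).
Hypotheses (be1 : 1 <= be) (beal : be <= al)
  (ineq1 : al^-1 + be^-1 ^+ th3 <= 1) (ineq2 : be^-1 + al^-1 ^+ th <= 1).

Let al1 : 1 <= al. Proof. exact: le_trans beal. Qed.
Let al0 : 0 < al. Proof. exact: lt_le_trans al1. Qed.
Let be0 : 0 < be. Proof. exact: lt_le_trans be1. Qed.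

Lemma weight_ge1 L X : 1 <= weight th al be L X.
Proof. by rewrite mulr_ege1 // exprn_ege1. Qed.

Let expr_drop (x : R) m k n : 1 <= x -> (m + k <= n)%N -> x ^+ m <= x ^+ n * x^-1 ^+ k.
Proof.
move=> x1 h; have x0 : 0 < x by exact: lt_le_trans x1.
by rewrite exprVn ler_pdivlMr ?exprn_gt0 // -exprD ler_weXn2l.
Qed.

Let weight_drop L X X' k l : (num1 L X'.1 + k <= num1 L X.1)%N ->
  (pot th L X' + l <= pot th L X)%N ->
  weight th al be L X' <= weight th al be L X * (al^-1 ^+ k * be^-1 ^+ l).
Proof.
move=> hk hl; rewrite /weight mulrACA; apply: ler_pM; rewrite ?exprn_ge0 ?(ltW al0) ?(ltW be0) //.
  exact: expr_drop.
exact: expr_drop.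
Qed.

(** The second and third alternatives are exactly [ineq2] and [ineq1]. The first gives
    [al^-1 + al^-1 ^ th], which [ineq2] covers because [be <= al]. *)
Lemma weight_branch L C X X1 X2 : step_spec th th3 L C X [:: X1; X2] ->
  weight th al be L X1 + weight th al be L X2 <= weight th al be L X.
Proof.
move=> h; inversion h as [|Y1 Y2 _ _ _ u1 u2 v1 v2 hor]; subst.
have W0 : 0 <= weight th al be L X by apply: le_trans (weight_ge1 L X).
have ab : al^-1 <= be^-1 by rewrite lef_pV2.
have fin x y : weight th al be L X1 <= weight th al be L X * x ->
    weight th al be L X2 <= weight th al be L X * y -> x + y <= 1 ->
    weight th al be L X1 + weight th al be L X2 <= weight th al be L X.
  move=> h1 h2 h3; apply: le_trans (lerD h1 h2) _; rewrite -mulrDr.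
  by rewrite ler_piMr.
case: hor => -[h1 h2].
- apply: (fin (al^-1 ^+ 1 * be^-1 ^+ 0) (al^-1 ^+ th * be^-1 ^+ 0)).
  + by apply: weight_drop => //; rewrite addn0.
  + by apply: weight_drop => //; rewrite addn0.
  + by rewrite !expr0 !mulr1 expr1; apply: le_trans ineq2; rewrite lerD2r.
- apply: (fin (al^-1 ^+ 0 * be^-1 ^+ 1) (al^-1 ^+ th * be^-1 ^+ 0)).
  + by apply: weight_drop => //; rewrite addn0.
  + by apply: weight_drop => //; rewrite addn0.
  + by rewrite !expr0 mulr1 mul1r expr1.
- apply: (fin (al^-1 ^+ 1 * be^-1 ^+ 0) (al^-1 ^+ 0 * be^-1 ^+ th3)).
  + by apply: weight_drop => //; rewrite addn0.
  + by apply: weight_drop => //; rewrite addn0.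
  + by rewrite !expr0 mulr1 mul1r expr1.
Qed.

End Weight.

Section Loop.

Variables (R : realType) (th th3 : nat) (al be : R).
Hypotheses (th_gt0 : (0 < th)%N) (th3_gt0 : (0 < th3)%N).
Hypotheses (be1 : 1 <= be) (beal : be <= al)
  (ineq1 : al^-1 + be^-1 ^+ th3 <= 1) (ineq2 : be^-1 + al^-1 ^+ th <= 1).

Variables (cst : nat -> com) (k : nat).
Hypothesis cstP : forall j (a : nat * seq triple * state lit) s, s j = enc a ->
  exists t s', [/\ exec (cst j) s t s', s' j = enc (stage th th3 a),
    forall i, (i < j)%N -> s' i = s i, (t <= (esize a).+2 ^ k)%N &
    (esize (stage th th3 a) <= (esize a).+2 ^ k)%N].

Variables (p : com) (n : nat) (C : seq triple).
Hypothesis C_lits : forall t, t \in C ->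
  [/\ t.1.1 \in lits n.+1, t.1.2 \in lits n.+1 & t.2 \in lits n.+1].
Hypothesis C_sym : forall a b c, (a, b, c) \in C -> (b, a, c) \in C /\ (a, c, b) \in C.

Variable tau : R.
Hypothesis tau_branch : forall X, good th (lits n.+1) X ->
  (42 + (esize (n, C, X)).+2 ^ k)%:R <= tau.
Hypothesis tau_stop : forall X, good th (lits n.+1) X ->
  sparse th th3 (lits n.+1) C X -> exists t y,
  [/\ runs p (enc_instance (instance_of n C X)) t y,
      y <> Leaf <-> has_offensive_alliance (instance_of n C X) &
      (42 + (esize (n, C, X)).+2 ^ k + 2 * (cvars p).+1 + t)%:R <= tau].

Let L := lits n.+1.
Let satX X := exists a, sat (lit_sat a) C X.
(* A binary tree with [w] leaves has [2 * w - 1] nodes. *)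
Let W X : R := 2 * weight th al be L X - 1.

Let W_ge1 X : 1 <= W X.
Proof. by have := @weight_ge1 R th al be be1 beal L X; rewrite /W; lra. Qed.

(** Every round lowers the sum of [W] over the stack by at least 1: a leaf has [W >= 1], and
    replacing a node by its children loses 1 by [weight_branch]. The sum is real, so the induction
    runs on a natural number [K] above it; each unit of the sum pays [tau]. *)
Lemma loop_exec K (st : seq (state lit)) s :
  (forall X, X \in st -> good th L X) -> s 1%N = enc (n, C) -> s 2 = enc st ->
  \sum_(X <- st) W X <= K%:R ->
  exists t s', [/\ exec (While (Var 2) (loop_body cst p)) s t s',
    s' 0%N <> Leaf <-> s 0%N <> Leaf \/ (exists2 X, X \in st & satX X) &
    t%:R <= 2 + (\sum_(X <- st) W X) * tau].
Proof.
elim: K st s => [|K IH] [|X r] s gst s1 s2 hW.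
- exists 2%N, s; split; last by rewrite big_nil mul0r addr0.
    by apply: (@exec_while_false (Var 2)); rewrite /= s2.
  by split; [left|case=> // -[]].
- exfalso; have : 0 <= \sum_(Y <- r) W Y by apply: sumr_ge0 => Y _; have := W_ge1 Y; lra.
  by rewrite big_cons in hW; have := W_ge1 X; lra.
- exists 2%N, s; split; last by rewrite big_nil mul0r addr0.
    by apply: (@exec_while_false (Var 2)); rewrite /= s2.
  by split; [left|case=> // -[]].
have gX : good th L X by apply: gst; rewrite mem_head.
have gr Y : Y \in r -> good th L Y by move=> hY; apply: gst; rewrite inE hY orbT.
have tau0 : 0 <= tau by apply: le_trans (tau_branch gX).
have step_cost st' t1 t2 : \sum_(Y <- st') W Y + 1 <= \sum_(Y <- X :: r) W Y ->
    (2 + t1)%:R <= tau -> t2%:R <= 2 + (\sum_(Y <- st') W Y) * tau ->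
    (2 + t1 + t2)%:R <= 2 + (\sum_(Y <- X :: r) W Y) * tau.
  move=> h1 h2 h3; have := ler_wpM2r tau0 h1; rewrite natrD mulrDl mul1r; lra.
have := stepP (uniq_lits n.+1) th_gt0 th3_gt0 C_lits C_sym gX.
case E: (step th th3 (lits n.+1) C X) => [|X1 l] spec.
- have sp : sparse th th3 L C X by inversion spec.
  have [tp [y [hrun hy htau]]] := tau_stop gX sp.
  have [t1 [q [ex q0 q1 q2 ht]]] := body_stop cstP s1 s2 E hrun.
  have hM : \sum_(Y <- r) W Y + 1 <= \sum_(Y <- X :: r) W Y.
    by rewrite big_cons addrC lerD2r.
  have [|||t2 [s' [ex2 hs' ht2]]] := IH r q gr; rewrite ?q1 ?q2 //.
    by move: hM hW; rewrite -natr1; lra.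
  exists (2 + t1 + t2)%N, s'; split.
  + by apply: (@exec_while_true (Var 2)) ex ex2; rewrite /= s2.
  + rewrite hs' q0; have yX : y <> Leaf <-> satX X.
      by rewrite hy; exact: instance_correct C_lits (good1 gX) (good2 gX).
    split=> [[hq|[Y Yr hY]]|[hq|[Y]]].
    * case: y hq yX {hrun hy htau ht q0} => [|? ?] hq yX; first by left.
      by right; exists X; [rewrite mem_head|apply/yX].
    * by right; exists Y => //; rewrite inE Yr orbT.
    * by left; case: (y).
    * rewrite inE => /orP[/eqP -> /yX hX|Yr hY]; last by right; exists Y.
      by left; case: (y) hX.
  + apply: (step_cost r) => //; apply: le_trans htau; rewrite ler_nat.
    by apply: leq_trans (leq_add (leqnn 2) ht) _; rewrite !addnA.
- have [X2 el] : exists X2, l = [:: X2] by inversion spec as [|Y1 Y2]; exists Y2.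
  subst l; have [t1 [q [ex q0 q1 q2 ht]]] := body_branch cstP p s1 s2 E.
  have hw := weight_branch be1 beal ineq1 ineq2 spec.
  inversion spec as [|Y1 Y2 g1 g2 hsat _ _ _ _ _]; subst Y1 Y2.
  have hM : \sum_(Y <- [:: X1, X2 & r]) W Y + 1 <= \sum_(Y <- X :: r) W Y.
    by rewrite !big_cons /W; move: hw; rewrite -/L; lra.
  have [||||t2 [s' [ex2 hs' ht2]]] := IH [:: X1, X2 & r] q; rewrite ?q1 ?q2 //.
  + by move=> Y; rewrite !inE => /or3P[/eqP ->|/eqP ->|/gr].
  + by move: hM hW; rewrite -natr1; lra.
  exists (2 + t1 + t2)%N, s'; split.
  + by apply: (@exec_while_true (Var 2)) ex ex2; rewrite /= s2.
  + rewrite hs' q0; split=> -[hq|[Y]]; try by left.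
    * rewrite !inE => /or3P[/eqP ->|/eqP ->|Yr] [a ha]; right.
      - by exists X; [rewrite mem_head|exists a; rewrite hsat ha].
      - by exists X; [rewrite mem_head|exists a; rewrite hsat ha orbT].
      - by exists Y; [rewrite inE Yr orbT|exists a].
    * rewrite inE => /orP[/eqP -> [a ha]|Yr hY]; right.
        move: ha; rewrite hsat => /orP[] ha.
          by exists X1; [rewrite mem_head|exists a].
        by exists X2; [rewrite !inE eqxx orbT|exists a].
      by exists Y => //; rewrite !inE Yr !orbT.
  + apply: (step_cost [:: X1, X2 & r]) => //; apply: le_trans (tau_branch gX).
    by rewrite ler_nat; apply: leq_trans (leq_add (leqnn 2) ht) _; rewrite !addnA.
Qed.

End Loop.

Local Open Scope classical_set_scope.

(** * Subexponential bounds and the final time count *)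

Lemma powR2_ge1 (R : realType) (y : R) : 0 <= y -> 1 <= 2 `^ y.
Proof.
move=> hy; apply: le_trans (_ : 2 `^ 0 <= _); first by rewrite powRr0.
by apply: ler_powR => //; lra.
Qed.

(** Beyond some [N0] the exponent is at most [eta * N]; the finitely many earlier values are
    absorbed by [K]. *)
Lemma littleo_pow2_bound (R : realType) (f : nat -> R) (eta : R) : 0 < eta ->
  (f =o_\oo (fun n => n%:R : R))%R ->
  exists2 K : R, 1 <= K & forall N, 2 `^ f N <= K * 2 `^ (eta * N%:R).
Proof.
move=> eta0 /eqoP /(_ eta eta0) [N0 _ hN0].
have p0 (x : R) : 0 <= 2 `^ x by exact: powR_ge0.
exists (1 + \sum_(i < N0) 2 `^ f i).
  by rewrite lerDl sumr_ge0.
move=> N; have h1 : 1 <= 2 `^ (eta * N%:R) :> R.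
  by apply: powR2_ge1; rewrite mulr_ge0 // ltW.
have [NN|NN] := leqP N0 N.
  have := hN0 N NN; rewrite /= [`|N%:R|]ger0_norm // => h.
  have h2 : 2 `^ f N <= 2 `^ (eta * N%:R) :> R.
    by apply: ler_powR; [lra|exact: le_trans (ler_norm _) h].
  apply: le_trans h2 _; rewrite ler_peMl // lerDl sumr_ge0 //.
apply: le_trans (_ : 1 + \sum_(i < N0) 2 `^ f i <= _); last first.
  by rewrite ler_peMr // addr_ge0 // sumr_ge0.
rewrite (bigD1 (Ordinal NN)) //= addrCA lerDl addr_ge0 // sumr_ge0 //.
Qed.

Definition sat_program (cc cst : nat -> com) (p : com) : com :=
  Seq (cc 0%N) (Seq (Assign 1 (Var 0)) (Seq (Assign 2 (Cons (Cons Nil Nil) Nil))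
    (Seq (Assign 0 Nil) (While (Var 2) (loop_body cst p))))).

Lemma good_nil th (L : seq lit) : good th L ([::], [::]).
Proof.
split; rewrite ?sub0seq //=.
by move=> a _; rewrite /deg2 big1.
Qed.

(** A good state consists of subsequences of the literals and of their pairs, so one polynomial
    bounds its size at every node of the branching tree. *)
Lemma polytime_state_bound : exists2 g, poly_bounded g &
  forall x th X, good th (lits x.1.+1) X ->
    (esize (x.1, (context x).2, X) <= g (esize x))%N.
Proof.
have [g1 pb1 h1] := polytime_esize polytime_context.
have h : polytime (fun x : nat * seq (seq lit) => (lits x.1.+1, pairs (lits x.1.+1))).
  by rewrite /pairs; polytime_solve.
have [g2 pb2 h2] := polytime_esize h.
exists (fun n => g1 n + g2 n + 1)%N; first by pbt.
move=> x th X gX; have := h1 x; have := h2 x.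
rewrite [X in (X <= _)%N -> _]esize_pair /= => h3 h4.
rewrite esize_pair /= addn1 ltnS leq_add // esize_pair; apply: leq_trans h3.
by rewrite ltnS leq_add // esize_subseq // ?(good1 gX) ?(good2 gX).
Qed.

Lemma not_ETH_of_bipartite (R : realType) :
  OA_subexponential R bipartite -> ~ ETH R.
Proof.
move=> [p [f [hf hp]]] [delta delta0]; apply.
(* There are [2 * n.+1] literals, and the initial potential doubles the exponent of [al], so the
   root weight is [al ^ (4 * n.+1)]: an eighth of [delta] becomes a half. *)
have e0 : 0 < delta / 8 by apply: divr_gt0.
have [th [th3 [al [be [/andP[th0 th30] be1 beal [beE alE] [i1 i2]]]]]] := thresholds_exist e0.
have [cc [kc ccP]] := polytime_context.
have [cst [ks cstP]] := polytime_stage th th3.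
have [g pbg hg] := polytime_state_bound.
pose Kn := (21 + 4 * (th + th3))%N.
have Kn0 : 0 < Kn%:R :> R by rewrite ltr0n.
(* Chosen so that a graph of order [Kn * n.+1] costs [2 ^ (delta / 2 * n.+1)], up to the factor
   [K]. *)
have eta0 : 0 < delta / (2 * Kn%:R) by apply: divr_gt0 => //; apply: mulr_gt0.
have [K K1 hK] := littleo_pow2_bound eta0 hf.
pose G S := (42 + (g S).+2 ^ ks + 2 * (cvars p).+1)%N.
have [k' hk'] : poly_bounded (fun S => S.+2 ^ kc + 12 + 2 * (G S + 1))%N.
  by rewrite /G; pbt.
(* The factor [2 ^ delta] pays for [n.+1] in place of [n], and [3 ^+ k'] for replacing [S.+2] by
   [3 * S]. *)
exists (sat_program cc cst p), (K * 2 `^ delta * 3 ^+ k'), k'.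
move=> phi phi3.
set x := plain_cnf phi; set n := nvars phi; set C := (context x).2.
set S := tree_size (enc_cnf phi).
have SE : S = esize x by rewrite /S enc_plain_cnf.
have C_lits t : t \in C -> [/\ t.1.1 \in lits n.+1, t.1.2 \in lits n.+1 & t.2 \in lits n.+1].
  exact: context_lits.
have C_sym a b c : (a, b, c) \in C -> (b, a, c) \in C /\ (a, c, b) \in C.
  exact: context_sym.
pose Tp : R := K * 2 `^ (delta / 2 * n.+1%:R).
have half0 : 0 <= delta / 2 * n.+1%:R by apply: mulr_ge0 => //; lra.
have Tp1 : 1 <= Tp by rewrite /Tp mulr_ege1 // powR2_ge1.
have hgX X : good th (lits n.+1) X -> (esize (n, C, X) <= g S)%N.
  by rewrite SE; exact: (hg x).
have hgE X : good th (lits n.+1) X -> ((esize (n, C, X)).+2 ^ ks <= (g S).+2 ^ ks)%N.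
  by move=> /hgX h; case: (ks) => // j; rewrite leq_exp2r.
pose tau : R := (G S)%:R + Tp.
have tau_branch X : good th (lits n.+1) X -> (42 + (esize (n, C, X)).+2 ^ ks)%:R <= tau.
  move=> /hgE h; apply: le_trans (_ : (G S)%:R <= _); last by rewrite lerDl; lra.
  by rewrite ler_nat /G -addnA leq_add2l; apply: leq_trans h (leq_addr _ _).
have tau_stop X : good th (lits n.+1) X -> sparse th th3 (lits n.+1) C X ->
    exists t y, [/\ runs p (enc_instance (instance_of n C X)) t y,
      y <> Leaf <-> has_offensive_alliance (instance_of n C X) &
      (42 + (esize (n, C, X)).+2 ^ ks + 2 * (cvars p).+1 + t)%:R <= tau].
  move=> gX sX; have [|t [y [h1 h2 h3]]] := hp (instance_of n C X).
    by split=> //; exact: bipartite_graph_of.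
  exists t, y; split=> //; rewrite natrD lerD //.
    by rewrite ler_nat /G leq_add2r leq_add2l hgE.
  apply: le_trans h3 _; apply: le_trans (hK _) _; rewrite /Tp ler_wpM2l //; first lra.
  apply: ler_powR; first lra.
  have := gorder_le (good1 gX) sX.
  rewrite -/Kn -(ler_nat R) natrM => h; apply: le_trans (ler_wpM2l (ltW eta0) h) _.
  rewrite le_eqVlt; apply/orP; left; apply/eqP.
  by move: Kn0; clear; set a : R := Kn%:R => a0; field; rewrite gt_eqF.
have [|tc [s1 [ex1 s10 _ tc1 _]]] := ccP 0%N x (upd (fun=> Leaf) 0 (enc_cnf phi)).
  by rewrite /upd /= enc_plain_cnf.
pose s4 := upd (upd (upd s1 1 (s1 0%N)) 2 (Node (Node Leaf Leaf) Leaf)) 0 Leaf.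
have w0 : weight th al be (lits n.+1) ([::], [::]) = 2 `^ (delta / 2 * n.+1%:R).
  rewrite /weight /pot /num2 /= big1; last by move=> a _; rewrite /deg2 big1.
  have -> : num1 (lits n.+1) [::] = (2 * n.+1)%N.
    rewrite /num1 -size_lits -sum1_size; exact: eq_bigr.
  rewrite subn0 [be ^+ _]exprM beE -exprD addnn -mul2n mulnA alE -powR_mulrn ?powR_ge0 // -powRrM.
  by congr powR; rewrite natrM; field.
have w1 := weight_ge1 th be1 beal (lits n.+1) ([::], [::]).
have [||||tl [s5 [ex2 hs5 ht2]]] := loop_exec th0 th30 be1 beal i1 i2 cstP C_lits C_sym
    tau_branch tau_stop (K := (Num.trunc (\sum_(X <- [:: ([::], [::])])
     (2 * weight th al be (lits n.+1) X - 1))).+1) (st := [:: ([::], [::])]) (s := s4).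
- by move=> X; rewrite inE => /eqP ->; exact: good_nil.
- by rewrite /s4 /upd /= s10.
- by [].
- by apply/ltW/truncnS_gt.
exists (tc + (2 + (6 + (2 + tl))))%N, (s5 0%N); split.
- exists s5; split=> //; apply: exec_seq ex1 _.
  apply: exec_seq; first exact: (exec_assign 1 (Var 0)).
  apply: exec_seq; first exact: (exec_assign 2 (Cons (Cons Nil Nil) Nil)).
  apply: exec_seq; first exact: (exec_assign 0 Nil).
  exact: ex2.
- rewrite hs5 satisfiable_context //; split=> [[//|[X]]|h]; last first.
    by right; exists ([::], [::]); rewrite ?mem_head.
  by rewrite inE => /eqP ->.
have S0 : (0 < S)%N by rewrite SE; exact: esize_gt0.
move: ht2; rewrite big_seq1 w0 => ht2.
set w : R := 2 `^ (delta / 2 * n.+1%:R) in ht2 w0.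
rewrite w0 in w1.
have TpE : Tp = K * w by [].
have tau1 : tau <= Tp * (G S + 1)%:R.
  by rewrite /tau natrD mulrDr mulr1 lerD2r ler_peMl.
have h1 : (tc + (2 + (6 + (2 + tl))))%:R <= w * Tp * (S.+2 ^ kc + 12 + 2 * (G S + 1))%:R.
  have wT : 1 <= w * Tp by rewrite mulr_ege1.
  have w00 : 0 <= w by lra.
  have h2 : w * tau <= w * Tp * (G S + 1)%:R by rewrite -mulrA; apply: ler_wpM2l.
  have h3 : tc%:R <= (S.+2 ^ kc)%:R :> R by rewrite ler_nat SE.
  have h4 : (S.+2 ^ kc + 12)%:R <= w * Tp * (S.+2 ^ kc + 12)%:R by rewrite ler_peMl.
  have tau0 : 0 <= tau by rewrite /tau addr_ge0 //; lra.
  have h5 : tl%:R <= 2 + 2 * (w * tau) by apply: le_trans ht2 _; rewrite mulrBl mulrA; lra.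
  have -> : (tc + (2 + (6 + (2 + tl))))%N = (tc + tl + 10)%N by clear; lia.
  rewrite [X in _ <= _ * X]natrD natrM mulrDr [X in X <= _]natrD [X in X + _ <= _]natrD.
  have h6 : (S.+2 ^ kc + 12)%:R = (S.+2 ^ kc)%:R + 12 :> R by rewrite natrD.
  move: h2 h3 h4 h5; rewrite h6; move: (w * Tp) (w * tau) (G S + 1)%:R => a b c.
  move: (S.+2 ^ kc)%:R tc%:R tl%:R => d t1 t2; clear; lra.
apply: le_trans h1 _.
have -> : w * Tp = K * 2 `^ delta * 2 `^ (delta * n%:R).
  rewrite TpE mulrCA -mulrA; congr (_ * _); rewrite /w -!powRD; last 2 first.
  - by apply/implyP => _; apply/negP => /eqP; lra.
  - by apply/implyP => _; apply/negP => /eqP; lra.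
  by congr powR; rewrite -natr1; clear; field.
rewrite [X in _ <= X](_ : _ = K * 2 `^ delta * 2 `^ (delta * n%:R) * (3 * S%:R) ^+ k').
  apply: ler_wpM2l; first by rewrite !mulr_ge0 ?powR_ge0 //; lra.
  apply: le_trans (_ : (S.+2 ^ k')%:R <= _); first by rewrite ler_nat.
  rewrite natrX lerXn2r ?nnegrE ?mulr_ge0 //.
  rewrite -natrM ler_nat; move: S0; clear; lia.
rewrite exprMn; move: (2 `^ delta) (2 `^ _) (3 ^+ k') (S%:R ^+ k') => a b c d.
by clear; ring.
Qed.

Theorem theorem7 (R : realType) :
  ETH R ->
  ~ OA_subexponential R (fun _ : graph => True) /\
  ~ OA_subexponential R bipartite.
Proof.
move=> eth; have hb : ~ OA_subexponential R bipartite.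
  by move=> /not_ETH_of_bipartite; apply.
split=> // -[p [f [hf hp]]]; apply: hb; exists p, f; split=> // i [_ hi].
exact: hp.
Qed.
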